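(* Let $X:\Sigma\to\mathbb{S}^2\times\mathbb{R}$ be a minimal conformal immersion whose Gauss map $g$ is non-constant. If $\hat X:\Sigma\to\mathbb{S}^2\times\mathbb{R}$ is another minimal conformal immersion with the same Gauss map as $X$, then $\hat X=f\circ X$ for some isometry $f$ of $\mathbb{S}^2\times\mathbb{R}$ given either by $f=(\mathrm{Id},T)$ or by $f=(\mathcal{A},T)$, where $\mathcal{A}$ denotes the antipodal map of $\mathbb{S}^2$ and $T$ is a translation of $\mathbb{R}$.
   Context: Model: $\mathbb{S}^2\times\mathbb{R}$ (with $\mathbb{S}^2$ the unit sphere and the product metric) is identified with $\mathbb{R}^3\setminus\{0\}$ with the metric $d\mu^2=|x|^{-2}(dx_1^2+dx_2^2+dx_3^2)$ through the isometry $(y,t)\mapsto e^t y$. In this model the isometry $(M,T)$ with $M\in O(3)$, $T(t)=t+s$, is $x\mapsto e^sM(x)$; thus $(\mathrm{Id},T)$ is $x\mapsto e^s x$ and $(\mathcal{A},T)$ is $x\mapsto -e^s x$. $\Sigma$ is a connected oriented Riemannian surface, with orientation-compatible local conformal coordinates $z=u+iv$; conformal immersions are conformal with respect to the fixed conformal structure of $\Sigma$, and minimal means zero mean curvature with respect to $d\mu^2$. Gauss map: $E_j(x)=|x|\partial_{x_j}$, $j=1,2,3$, is a global orthonormal frame. Let $N=N_1E_1+N_2E_2+N_3E_3$ be the unit normal of $X$ in the direction of $X_u\times X_v$. The Gauss map of $X$ is $$g=\frac{N_1+iN_2}{1+N_3}:\Sigma\to\bar{\mathbb{C}}=\mathbb{C}\cup\{\infty\},$$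 i.e. $N\in\mathbb{S}^2\subset\mathbb{R}^3$ composed with stereographic projection from the south pole. *)

(* Defs.v *)
From HB Require Import structures.
From mathcomp Require Import all_boot all_order all_algebra.
From mathcomp Require Import all_classical all_reals all_analysis.
From mathcomp Require Import complex.

Set Implicit Arguments.
Unset Strict Implicit.
Unset Printing Implicit Defensive.

Import Order.TTheory GRing.Theory Num.Theory.
Import numFieldNormedType.Exports.

Local Open Scope classical_set_scope.
Local Open Scope ring_scope.

Section Calculus.
Context {R : realType}.

Definition partial n (V : normedModType R) (a : 'I_n) (f : 'rV[R]_n -> V)
  (x : 'rV[R]_n) : V := 'D_(delta_mx 0 a) f x.

(* Meant for an open set U; only the values of f on U matter. *)
Fixpoint Ck_on n (V : normedModType R) (k : nat) (U : set 'rV[R]_n)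
    (f : 'rV[R]_n -> V) : Prop :=
  if k is k'.+1 then
    (forall x, U x -> differentiable f x) /\
    (forall a : 'I_n, Ck_on k' U (partial a f))
  else forall x, U x -> {for x, continuous f}.

Definition smooth_on n (V : normedModType R) (U : set 'rV[R]_n)
  (f : 'rV[R]_n -> V) : Prop := forall k, Ck_on k U f.

End Calculus.

(* The values of coord outside dom, and of param outside coord @` dom, are
   irrelevant. *)
Record chart (R : realType) (T : topologicalType) := Chart {
  dom : set T;
  coord : T -> 'rV[R]_2;
  param : 'rV[R]_2 -> T;
  dom_open : open dom;
  cod_open : open (coord @` dom);
  coordK : forall p, dom p -> param (coord p) = p;
  coord_continuous : forall p, dom p -> {for p, continuous coord};
  param_continuous :
    forall z, (coord @` dom) z -> {for z, continuous param} }.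

Definition transition (R : realType) (T : topologicalType) (c c' : chart R T) :
  'rV[R]_2 -> 'rV[R]_2 := coord c' \o param c.

Definition overlap (R : realType) (T : topologicalType) (c c' : chart R T) :
  set 'rV[R]_2 := coord c @` (dom c `&` dom c').

(* A connected oriented Riemannian surface, given by its orientation-compatible
   conformal coordinates z = (u, v): in the chart c of the atlas the metric is
   cfactor c z * (du^2 + dv^2).
   Rows of a Jacobian matrix are partial derivatives ('D_v f p = v *m 'J f p),
   hence the shape of the pulled-back metric in transition_isometric. *)
Record riemannian_surface (R : realType) := RiemannianSurface {
  surface_carrier :> topologicalType;
  surface_hausdorff : hausdorff_space surface_carrier;
  surface_second_countable : @second_countable surface_carrier;
  surface_connected : connected [set: surface_carrier];
  atlas : set (chart R surface_carrier);
  atlas_cover : forall p, exists c, atlas c /\ dom c p;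
  transition_smooth : forall c c', atlas c -> atlas c' ->
    smooth_on (overlap c c') (transition c c');
  transition_oriented : forall c c', atlas c -> atlas c' ->
    forall z, overlap c c' z -> 0 < \det ('J (transition c c') z);
  cfactor : chart R surface_carrier -> 'rV[R]_2 -> R;
  cfactor_gt0 : forall c, atlas c ->
    forall z, (coord c @` dom c) z -> 0 < cfactor c z;
  cfactor_smooth : forall c, atlas c ->
    smooth_on (coord c @` dom c) (cfactor c);
  transition_isometric : forall c c', atlas c -> atlas c' ->
    forall z, overlap c c' z ->
      'J (transition c c') z *m (cfactor c' (transition c c' z))%:M
        *m ('J (transition c c') z)^T = (cfactor c z)%:M }.

Section Ambient.
Context {R : realType}.

Definition dot (x y : 'rV[R]_3) : R := \sum_i x 0 i * y 0 i.

Definition enorm (x : 'rV[R]_3) : R := Num.sqrt (dot x x).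

(* Indices are taken modulo 3. *)
Definition cross (x y : 'rV[R]_3) : 'rV[R]_3 :=
  \row_(k < 3) (x 0 (k + 1) * y 0 (k + 2) - x 0 (k + 2) * y 0 (k + 1)).

Definition dmu2 (x : 'rV[R]_3) : 'M[R]_3 := (enorm x ^- 2)%:M.

Definition dmu2_inner (x v w : 'rV[R]_3) : R := (v *m dmu2 x *m w^T) 0 0.

Definition christoffel (x : 'rV[R]_3) (k i j : 'I_3) : R :=
  2^-1 * \sum_l (invmx (dmu2 x)) k l *
    (partial i (fun y => dmu2 y j l) x + partial j (fun y => dmu2 y i l) x
     - partial l (fun y => dmu2 y i j) x).

Definition frame (j : 'I_3) (x : 'rV[R]_3) : 'rV[R]_3 :=
  enorm x *: delta_mx 0 j.

(* For the remaining definitions of this section, F is a local immersion of an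
   open set of R^2 into R^3 \ {0}, and the rows of 'J F z are F_u and F_v. *)

(* The coefficients (N_1, N_2, N_3) in the frame E_j of the unit normal in the
   direction of F_u x F_v: as dmu^2 is conformal to the Euclidean metric, they
   are the components of the Euclidean unit normal. *)
Definition normal_coef (F : 'rV[R]_2 -> 'rV[R]_3) (z : 'rV[R]_2) : 'rV[R]_3 :=
  let w := cross (partial 0 F z) (partial 1 F z) in (enorm w)^-1 *: w.

Definition unit_normal (F : 'rV[R]_2 -> 'rV[R]_3) (z : 'rV[R]_2) : 'rV[R]_3 :=
  \sum_j normal_coef F z 0 j *: frame j (F z).

Definition first_ff (F : 'rV[R]_2 -> 'rV[R]_3) (z : 'rV[R]_2) : 'M[R]_2 :=
  'J F z *m dmu2 (F z) *m ('J F z)^T.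

(* The covariant derivative, for the Levi-Civita connection of dmu^2, of the
   coordinate field F_b along F in the coordinate direction a. *)
Definition cov_deriv (F : 'rV[R]_2 -> 'rV[R]_3) (z : 'rV[R]_2) (a b : 'I_2) :
    'rV[R]_3 :=
  \row_k (partial a (partial b F) z 0 k +
    \sum_i \sum_j christoffel (F z) k i j
      * partial a F z 0 i * partial b F z 0 j).

Definition second_ff (F : 'rV[R]_2 -> 'rV[R]_3) (z : 'rV[R]_2) : 'M[R]_2 :=
  \matrix_(a, b) dmu2_inner (F z) (cov_deriv F z a b) (unit_normal F z).

Definition mean_curvature (F : 'rV[R]_2 -> 'rV[R]_3) (z : 'rV[R]_2) : R :=
  2^-1 * \tr (invmx (first_ff F z) *m second_ff F z).

(* None is the point at infinity. *)
Definition stereographic (n : 'rV[R]_3) : one_point_compactification R[i] :=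
  if n 0 2 == -1 then None
  else Some (Complex (n 0 0) (n 0 1) / Complex (1 + n 0 2) 0).

End Ambient.

Section ProductSpace.
Variable R : realType.

Definition sphere2 : Type := {y : 'rV[R]_3 | dot y y == 1}.

Definition S2xR : Type := (sphere2 * R)%type.

Definition model (q : S2xR) : 'rV[R]_3 := expR q.2 *: sval q.1.

Lemma antipode_subproof (y : sphere2) : dot (- sval y) (- sval y) == 1.
Proof.
case: y => y /= /eqP <-; apply/eqP/eq_bigr => i _.
by rewrite !mxE mulrNN.
Qed.

Definition antipode (y : sphere2) : sphere2 :=
  exist _ (- sval y) (antipode_subproof y).

Definition translation (s : R) : R -> R := fun t => t + s.

Definition prod_map (M : sphere2 -> sphere2) (T : R -> R) : S2xR -> S2xR :=
  fun q => (M q.1, T q.2).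

End ProductSpace.

Section Immersions.
Context {R : realType} {S : riemannian_surface R}.
Implicit Types (X : S -> S2xR R) (c : chart R S).

Definition local_rep X c : 'rV[R]_2 -> 'rV[R]_3 :=
  fun z => model (X (param c z)).

Definition immersion X : Prop := forall c, atlas c ->
  smooth_on (coord c @` dom c) (local_rep X c) /\
  (forall z, (coord c @` dom c) z -> row_free ('J (local_rep X c) z)).

Definition conformal X : Prop := forall c, atlas c ->
  forall z, (coord c @` dom c) z ->
  exists rho : R, 0 < rho /\
    first_ff (local_rep X c) z = rho *: (cfactor c z)%:M.

Definition minimal X : Prop := forall c, atlas c ->
  forall z, (coord c @` dom c) z -> mean_curvature (local_rep X c) z = 0.

Definition minimal_conformal_immersion X : Prop :=
  [/\ immersion X, conformal X & minimal X].

(* The normal does not depend on the oriented chart used to compute it. *)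
Definition chart_at (p : S) : chart R S := projT1 (cid (atlas_cover p)).

Definition gauss_map X (p : S) : one_point_compactification R[i] :=
  stereographic
    (normal_coef (local_rep X (chart_at p)) (coord (chart_at p) p)).

End Immersions.

(* Main.v *)
Require Import Defs.
From mathcomp Require Import all_boot all_order all_algebra.
From mathcomp Require Import all_classical all_reals all_analysis.
From mathcomp Require Import ring lra complex.

Set Implicit Arguments.
Unset Strict Implicit.
Unset Printing Implicit Defensive.

Import Order.TTheory GRing.Theory Num.Theory.
Import numFieldNormedType.Exports.

Local Open Scope classical_set_scope.
Local Open Scope ring_scope.

(** Read in a chart, an immersion becomes a map F with values in R^3 minus the
    origin; write N for its Euclidean unit normal and h = <F, N> / |F|^2 (here
    tilt F N). The ambient metric is conformal to the Euclidean one, and its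
    mean curvature vanishes exactly when the Euclidean mean curvature of F is
    - h. For a conformal F this puts the Weingarten equations in the form
      N_u - N x N_v = 2 h F_u,   N_v + N x N_u = 2 h F_v     (weingarten),
    so that N determines h dF.

    Let G be a second immersion with the same N. Where h does not vanish,
    dG = r dF for a real function r, which is locally constant because mixed
    partial derivatives commute; hence G = r F + C. Both F and F + C / r are
    then minimal with normal N. By inversion, which is an isometry of the
    ambient metric, such an F would be a piece of a cone over a vertex other
    than the origin, and no such cone is minimal unless h = 0; thus C = 0 and
    G = r F (translation_rigidity, local_homothety). The function h is not
    identically zero: otherwise F would always be tangent to the surface, which
    forces dN = 0 (tilt0_dN) and a constant Gauss map.

    To pass from an open set to the whole surface, use that log |F| is harmonic
    (log_norm_harmonic), being the coordinate on the factor R. The gradient of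
    log |G| - log |F| is a holomorphic function up to conjugation. It vanishes
    on an open set, hence everywhere, by unique continuation
    (harmonic_field_continuation); so |G| / |F| is constant (norm_ratio_constant).

    The zeros of h may fill an open set and separate the domains on which
    G = r F is known. This is bypassed by looking at k = <G, F> / |F|^2, whose
    differential vanishes at every point (pd_dot_ratio): where h is nonzero k is
    locally the constant r, and where h = 0 both F and G lie in the plane
    orthogonal to N, where d log |F| = d log |G| determines dF / F = dG / G as
    complex numbers. So k is constant, k^2 = |G|^2 / |F|^2, and the equality case
    of the Cauchy-Schwarz inequality gives G = k F on the surface. In terms of
    the product this is the translation by log |k| on R, together with the
    antipodal map when k < 0. *)

(** * Calculus of smooth functions on open sets *)

Lemma near_zero_differentiable (R : realType) (V W : normedModType R)
    (h : V -> W) x : (\forall y \near x, h y = 0) -> differentiable h x.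
Proof.
move=> h0.
pose z : {linear V -> W} := \0.
have zc : continuous z by move=> y; exact: (@cst_continuous _ _ (0 : W)).
have hz : h \o shift x = cst (h x) + z +o_ 0 id.
  apply/eqaddoP => e e0.
  have : \forall y \near 0, h (y + x) = 0.
    have := h0; rewrite (near_shift 0 x) /=.
    by apply: filterS => y /=; rewrite subr0.
  apply: filterS => y hy.
  rewrite /= !fctE /= hy (nbhs_singleton h0) addr0 subrr normr0.
  exact: mulr_ge0 (ltW e0) _.
by apply/diff_locallyP; rewrite (diff_unique zc hz).
Qed.

Fact pd_key : unit. Proof. exact: tt. Qed.

(** The partial derivative, locked: comparing two derivatives up to conversion
    would otherwise unfold both of them down to limits of filters. *)
Definition pd (R : realType) n (V : normedModType R) :
    'I_n -> ('rV[R]_n -> V) -> 'rV[R]_n -> V :=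
  locked_with pd_key (@partial R n V).

Lemma pdE (R : realType) n (V : normedModType R) : @pd R n V = @partial R n V.
Proof. by rewrite /pd unlock. Qed.

Section SmoothFunctions.
Context {R : realType} {n : nat}.
Implicit Types (U : set 'rV[R]_n) (a : 'I_n) (x : 'rV[R]_n).

Section Generic.
Variable V : normedModType R.
Implicit Types (f g : 'rV[R]_n -> V).

Lemma smooth_differentiable U f x :
  smooth_on U f -> U x -> differentiable f x.
Proof. by move=> /(_ 1%N)[+ _]; exact. Qed.

Lemma smooth_derivable U f x v : smooth_on U f -> U x -> derivable f x v.
Proof. by move=> sf Ux; exact/diff_derivable/(smooth_differentiable sf). Qed.

Lemma smooth_continuous U f x : smooth_on U f -> U x -> {for x, continuous f}.
Proof. by move=> /(_ 0%N); exact. Qed.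

Lemma smooth_partial U f a : smooth_on U f -> smooth_on U (pd a f).
Proof. by rewrite pdE => sf k; have [_] := sf k.+1; exact. Qed.

Lemma partial_ext U f g a x : open U -> (forall y, U y -> f y = g y) -> U x ->
  pd a f x = pd a g x.
Proof.
rewrite pdE => Uo fg Ux; apply: near_eq_derive.
by near do apply: fg; exact: open_nbhs_nbhs.
Unshelve. all: by end_near. Qed.

Lemma near_eq_differentiable f g x : (\forall y \near x, f y = g y) ->
  differentiable f x -> differentiable g x.
Proof.
move=> fg df; rewrite (_ : g = f + (g - f)); last by rewrite addrC subrK.
apply: differentiableD => //; apply: near_zero_differentiable.
by apply: filterS fg => y e; rewrite !fctE e subrr.
Qed.

Lemma Ck_on_ext k U f g : open U -> (forall y, U y -> f y = g y) ->
  Ck_on k U f -> Ck_on k U g.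
Proof.
move=> Uo; have nfg f' g' y : (forall y, U y -> f' y = g' y) -> U y ->
    \forall z \near y, f' z = g' z :> V.
  by move=> fg Uy; near do apply: fg; exact: open_nbhs_nbhs.
elim: k f g => [|k IH] f g fg /=.
  move=> cf x Ux; suff : g @ x --> f x by rewrite fg.
  exact: cvg_trans (near_eq_cvg (nfg _ _ _ fg Ux)) (cf x Ux).
move=> [df dk]; split=> [x Ux|a].
  exact: near_eq_differentiable (nfg _ _ _ fg Ux) (df x Ux).
by apply: IH (dk a) => y Uy; rewrite -pdE; exact: partial_ext fg Uy.
Unshelve. all: by end_near. Qed.

Lemma smooth_ext U f g : open U -> (forall y, U y -> f y = g y) ->
  smooth_on U f -> smooth_on U g.
Proof. by move=> Uo fg sf k; exact: Ck_on_ext fg (sf k). Qed.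

Lemma Ck_on_sub k U U' f : U' `<=` U -> Ck_on k U f -> Ck_on k U' f.
Proof.
move=> U'U; elim: k f => [|k IH] f /=; first by move=> cf x /U'U; exact: cf.
by move=> [df dk]; split=> [x /U'U|a]; [exact: df|exact: IH].
Qed.

Lemma smooth_sub U U' f : U' `<=` U -> smooth_on U f -> smooth_on U' f.
Proof. by move=> U'U sf k; exact: Ck_on_sub (sf k). Qed.

Lemma Ck_onW k U f : Ck_on k.+1 U f -> Ck_on k U f.
Proof.
elim: k f => [|k IH] f [df dk] /=.
  by move=> x Ux; exact/differentiable_continuous/df.
by split=> // a; exact: IH.
Qed.

Lemma Ck_on_cst k U (c : V) : Ck_on k U (fun=> c).
Proof.
elim: k c => [|k IH] c /=; first by move=> x _; exact: (@cst_continuous _ _ c).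
split=> [x _|a]; first exact: differentiable_cst.
rewrite (_ : partial _ _ = fun=> 0); first exact: IH.
by apply/funext => x; exact: derive_cst.
Qed.

Lemma smooth_cst U (c : V) : smooth_on U (fun=> c).
Proof. by move=> k; exact: Ck_on_cst. Qed.

Lemma partial_cst (c : V) a x : pd a (fun=> c) x = 0.
Proof. by rewrite pdE; exact: derive_cst. Qed.

Lemma Ck_onD k U f g : open U -> Ck_on k U f -> Ck_on k U g ->
  Ck_on k U (fun x => f x + g x).
Proof.
move=> Uo; elim: k f g => [|k IH] f g /=.
  by move=> cf cg x Ux; exact: continuousD (cf x Ux) (cg x Ux).
move=> [df pf] [dg pg]; split=> [x Ux|a].
  by apply: differentiableD; [exact: df|exact: dg].
apply: Ck_on_ext (IH _ _ (pf a) (pg a)) => // x Ux.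
by rewrite [RHS]deriveD//; apply: diff_derivable; [exact: df|exact: dg].
Qed.

Lemma smoothD U f g : open U -> smooth_on U f -> smooth_on U g ->
  smooth_on U (fun x => f x + g x).
Proof. by move=> Uo sf sg k; exact: Ck_onD. Qed.

Lemma partialD U f g a x : smooth_on U f -> smooth_on U g -> U x ->
  pd a (fun x => f x + g x) x = pd a f x + pd a g x.
Proof. by rewrite pdE => sf sg Ux; apply: deriveD; exact: smooth_derivable Ux. Qed.

Lemma Ck_on_sum k U m (f : 'I_m -> 'rV[R]_n -> V) : open U ->
  (forall i, Ck_on k U (f i)) -> Ck_on k U (fun x => \sum_i f i x).
Proof.
move=> Uo; elim: m f => [|m IH] f cf.
  rewrite (_ : (fun _ => _) = fun=> 0); first exact: Ck_on_cst.
  by apply/funext => x; rewrite big_ord0.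
rewrite (_ : (fun _ => _) =
    (fun x => f ord0 x + \sum_i f (lift ord0 i) x)); last first.
  by apply/funext => x; rewrite big_ord_recl.
by apply: Ck_onD => //; exact: IH.
Qed.

End Generic.

Section Scalar.
Implicit Types (f g : 'rV[R]_n -> R).

Lemma partialM U f g a x : smooth_on U f -> smooth_on U g -> U x ->
  pd a (fun x => f x * g x) x =
  pd a f x * g x + f x * pd a g x.
Proof.
rewrite pdE => sf sg Ux; rewrite /partial (deriveM (smooth_derivable sf Ux))//.
  by rewrite addrC [X in X + _]mulrC.
exact: smooth_derivable Ux.
Qed.

Lemma Ck_onM k U f g : open U -> Ck_on k U f -> Ck_on k U g ->
  Ck_on k U (fun x => f x * g x).
Proof.
move=> Uo; elim: k f g => [|k IH] f g.
  by move=> cf cg x Ux; exact: continuousM (cf x Ux) (cg x Ux).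
move=> /[dup] /Ck_onW cf [df pf] /[dup] /Ck_onW cg [dg pg].
split=> [x Ux|a].
  by apply: differentiableM; [exact: df|exact: dg].
apply: (Ck_on_ext Uo _ (Ck_onD Uo (IH _ _ (pf a) cg) (IH _ _ cf (pg a)))).
move=> x Ux; rewrite [RHS]deriveM; first by rewrite addrC [X in _ = _ + X]mulrC.
  by apply: diff_derivable; exact: df.
by apply: diff_derivable; exact: dg.
Qed.

Lemma smoothM U f g : open U -> smooth_on U f -> smooth_on U g ->
  smooth_on U (fun x => f x * g x).
Proof. by move=> Uo sf sg k; exact: Ck_onM. Qed.

Lemma smoothN U f : open U -> smooth_on U f -> smooth_on U (fun x => - f x).
Proof.
move=> Uo sf; have s1 : smooth_on U (fun=> -1 : R) by exact: smooth_cst.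
by apply: smooth_ext (smoothM Uo s1 sf) => // y _; rewrite mulN1r.
Qed.

Lemma smoothB U f g : open U -> smooth_on U f -> smooth_on U g ->
  smooth_on U (fun x => f x - g x).
Proof. by move=> Uo sf sg; apply: smoothD => //; exact: smoothN. Qed.

Lemma partialB U f g a x : smooth_on U f -> smooth_on U g -> U x ->
  pd a (fun x => f x - g x) x = pd a f x - pd a g x.
Proof. by rewrite pdE => sf sg Ux; apply: deriveB; exact: smooth_derivable Ux. Qed.

Lemma partialV U f a x : smooth_on U f -> U x -> f x != 0 ->
  pd a (fun x => (f x)^-1) x = - (pd a f x / f x ^+ 2).
Proof.
rewrite pdE => sf Ux f0; rewrite /partial deriveV//; last exact: smooth_derivable Ux.
by rewrite scaleNr mulrC.
Qed.

Lemma smoothV U f : open U -> smooth_on U f -> (forall x, U x -> f x != 0) ->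
  smooth_on U (fun x => (f x)^-1).
Proof.
move=> Uo sf f0; elim=> [|k IH].
  by move=> x Ux; exact: continuousV (f0 x Ux) (sf 0%N x Ux).
split=> [x Ux|a].
  by apply: differentiableV; [exact: smooth_differentiable Ux|exact: f0].
have sp : Ck_on k U (fun x => -1 * pd a f x).
  by apply: Ck_onM => //; [exact: Ck_on_cst|exact: smooth_partial].
apply: (Ck_on_ext Uo _ (Ck_onM Uo sp (Ck_onM Uo IH IH))) => x Ux.
rewrite -pdE (partialV _ sf)//; last exact: f0.
by rewrite -invfM expr2 mulN1r mulNr.
Qed.

End Scalar.
End SmoothFunctions.

(** * Mean value theorems, mixed partial derivatives, maxima *)

Section Lines.
Context {R : realType} {V : normedModType R}.
Implicit Types (x v w : V).

Lemma is_derive_line (W : normedModType R) (f : V -> W) x v (s : R) :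
  derivable f (s *: v + x) v ->
  is_derive s 1 (fun t => f (t *: v + x)) ('D_v f (s *: v + x)).
Proof.
move=> df.
have e : (fun h : R => h^-1 *: (((fun t : R => f (t *: v + x)) \o shift s)
      (h *: 1) - f (s *: v + x))) =
    (fun h => h^-1 *: ((f \o shift (s *: v + x)) (h *: v) - f (s *: v + x))).
  by apply/funext => h; rewrite /= [h *: 1]mulr1 scalerDl addrA.
by apply: DeriveDef; rewrite /derivable /derive e.
Qed.

Lemma translate_quotient (W : normedModType R) (f : V -> W) x v w :
  (fun h : R =>
     h^-1 *: (((fun y => f (w + y)) \o shift x) (h *: v) - f (w + x))) =
  (fun h => h^-1 *: ((f \o shift (w + x)) (h *: v) - f (w + x))).
Proof. by apply/funext => h /=; rewrite addrCA. Qed.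

Lemma derive_translate (W : normedModType R) (f : V -> W) x v w :
  'D_v (fun y => f (w + y)) x = 'D_v f (w + x).
Proof. by rewrite /derive translate_quotient. Qed.

Lemma derivable_translate (W : normedModType R) (f : V -> W) x v w :
  derivable f (w + x) v -> derivable (fun y => f (w + y)) x v.
Proof. by rewrite /derivable translate_quotient. Qed.

Lemma MVT_line (f : V -> R) x v (h : R) : 0 < h ->
  (forall t, 0 <= t <= h -> derivable f (t *: v + x) v) ->
  exists2 t, 0 <= t <= h & f (h *: v + x) - f x = h * 'D_v f (t *: v + x).
Proof.
move=> h0 df.
have dl t : 0 <= t <= h ->
    is_derive t 1 (fun t => f (t *: v + x)) ('D_v f (t *: v + x)).
  by move=> th; exact/is_derive_line/df.
have [||t] := @MVT R (fun t => f (t *: v + x))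
    (fun t => 'D_v f (t *: v + x)) 0 h h0.
- move=> t; rewrite in_itv/= => /andP[t0 th].
  by apply: dl; rewrite !ltW.
- apply: derivable_within_continuous => t; rewrite in_itv/= => th.
  by have [] := dl t th.
- rewrite in_itv/= => /andP[t0 th] e; exists t; first by rewrite !ltW.
  by move: e; rewrite scale0r add0r subr0 mulrC.
Qed.

End Lines.

Section Partials.
Context {R : realType} {n : nat}.
Implicit Types (U : set 'rV[R]_n) (a b : 'I_n) (x : 'rV[R]_n).

Lemma derive_sum_partial (V : normedModType R) (f : 'rV[R]_n -> V) x v :
  differentiable f x -> 'D_v f x = \sum_a v 0 a *: pd a f x.
Proof.
move=> df; rewrite deriveE// {1}(row_sum_delta v) linear_sum.
by apply: eq_bigr => a _; rewrite linearZ pdE /partial deriveE.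
Qed.

Lemma pdD (V : normedModType R) a (f : 'rV[R]_n -> V) x :
  pd a f x = 'D_(delta_mx 0 a) f x.
Proof. by rewrite pdE. Qed.

(** The mean value theorem in direction a, applied to the increment of f by
    h e_b, and then in direction b, applied to pd a f. *)
Lemma mixed_difference_MVT U (f : 'rV[R]_n -> R) a b x (h : R) :
  smooth_on U f -> 0 < h ->
  (forall s t, 0 <= s <= h -> 0 <= t <= h ->
    U (t *: delta_mx 0 b + (s *: delta_mx 0 a + x))) ->
  exists s t, [/\ 0 <= s <= h, 0 <= t <= h &
    f (h *: delta_mx 0 b + (h *: delta_mx 0 a + x))
    - f (h *: delta_mx 0 a + x) - (f (h *: delta_mx 0 b + x) - f x)
    = h ^+ 2 * pd b (pd a f) (t *: delta_mx 0 b + (s *: delta_mx 0 a + x))].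
Proof.
move=> sf h0 inU; set ea := delta_mx 0 a; set eb := delta_mx 0 b.
have zh : 0 <= (0 : R) <= h by rewrite lexx ltW.
have hh : 0 <= h <= h by rewrite lexx ltW.
pose g y := f (h *: eb + y) - f y.
have df t : 0 <= t <= h -> derivable f (t *: ea + x) ea.
  move=> th; have := smooth_derivable (v := ea) sf (inU t 0 th zh).
  by rewrite scale0r add0r.
have dfh t : 0 <= t <= h ->
    derivable (fun y => f (h *: eb + y)) (t *: ea + x) ea.
  move=> th; apply: derivable_translate.
  exact: smooth_derivable sf (inU t h th hh).
have [t th|s sh e] := @MVT_line R _ g x ea h h0.
  by apply: derivableB; [exact: dfh|exact: df].
have [t th|t th e'] := @MVT_line R _ (pd a f) (s *: ea + x) eb h h0.
  exact: smooth_derivable (smooth_partial a sf) (inU s t sh th).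
exists s, t; split => //.
rewrite -/(g (h *: ea + x)) -/(g x) e deriveB; [|exact: dfh|exact: df].
by rewrite derive_translate -!pdD e' -pdD mulrA expr2.
Qed.

Lemma norm_delta_mx_le1 a : `|delta_mx 0 a : 'rV[R]_n| <= 1.
Proof.
rewrite [leLHS]/Num.Def.normr/= mx_normrE; apply: bigmax_le => //= i _.
by rewrite mxE; case: (_ && _); rewrite ?normr1 ?normr0.
Qed.

Lemma ball_two_steps a b x (e s t : R) : 0 <= s -> 0 <= t -> s + t < e ->
  ball x e (t *: delta_mx 0 b + (s *: delta_mx 0 a + x)).
Proof.
move=> s0 t0 ste; rewrite -ball_normE /ball_/= addrA opprD addrCA subrr addr0 normrN.
rewrite (le_lt_trans _ ste)// addrC (le_trans (ler_normD _ _))//.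
rewrite !normrZ (ger0_norm s0) (ger0_norm t0).
by apply: lerD; rewrite ler_piMr// norm_delta_mx_le1.
Qed.

Lemma open_ball_sub U x : open U -> U x ->
  exists2 e : R, 0 < e & ball x e `<=` U.
Proof. by move=> Uo Ux; apply/nbhs_ballP; exact: open_nbhs_nbhs. Qed.

Lemma smooth_near_dist U (f : 'rV[R]_n -> R) x (e : R) :
  smooth_on U f -> U x -> 0 < e -> \forall y \near x, `|f x - f y| < e.
Proof.
move=> sf Ux e0.
exact: (@cvgr_dist_lt _ _ _ _ _ f (f x) (smooth_continuous sf Ux) e e0).
Qed.

(** Both mixed derivatives are limits of the same second difference quotient. *)
Lemma partialC U (f : 'rV[R]_n -> R) a b x : open U -> smooth_on U f -> U x ->
  pd a (pd b f) x = pd b (pd a f) x.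
Proof.
move=> Uo sf Ux; apply/eqP; rewrite -subr_eq0 -normr_eq0; apply/negPn/negP => d0.
pose d := `|pd a (pd b f) x - pd b (pd a f) x| / 2.
have dp : 0 < d by rewrite divr_gt0// lt_neqAle eq_sym d0 normr_ge0.
have sab : smooth_on U (pd a (pd b f)) by do 2!apply: smooth_partial.
have sba : smooth_on U (pd b (pd a f)) by do 2!apply: smooth_partial.
have : \forall y \near x, [/\ U y,
    `|pd a (pd b f) x - pd a (pd b f) y| < d &
    `|pd b (pd a f) x - pd b (pd a f) y| < d].
  have UN : \forall y \near x, U y by exact: open_nbhs_nbhs.
  apply: filterS3 UN (smooth_near_dist sab Ux dp) (smooth_near_dist sba Ux dp).
  move=> y Uy h1 h2; exact: And3 Uy h1 h2.
move=> /nbhs_ballP[e /= e0 xe].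
pose h := e / 3.
have h0 : 0 < h by rewrite divr_gt0.
have box a' b' s t : 0 <= s <= h -> 0 <= t <= h ->
    ball x e (t *: delta_mx 0 b' + (s *: delta_mx 0 a' + x)).
  move=> /andP[s0 sh] /andP[t0 th]; apply: ball_two_steps => //.
  by rewrite /h in sh th; lra.
have [|s [t [sh th E]]] := @mixed_difference_MVT U f a b x h sf h0.
  by move=> s t sh th; have [] := xe _ (box a b s t sh th).
have [|s' [t' [sh' th' E']]] := @mixed_difference_MVT U f b a x h sf h0.
  by move=> s' t' sh' th'; have [] := xe _ (box b a s' t' sh' th').
have [_ _ B] := xe _ (box a b s t sh th).
have [_ A _] := xe _ (box b a s' t' sh' th').
set p := t *: _ + _ in E B; set q := t' *: _ + _ in E' A.
have pq : pd a (pd b f) q = pd b (pd a f) p.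
  apply: (@mulfI _ (h ^+ 2)); first by rewrite expf_neq0// gt_eqF.
  apply: etrans (esym E') _; apply: etrans _ E.
  have -> : h *: delta_mx 0 a + (h *: delta_mx 0 b + x) =
    h *: delta_mx 0 b + (h *: delta_mx 0 a + x) by rewrite addrCA.
  move: (f (_ + (_ + _))) (f (h *: delta_mx 0 a + x)) (f (_ + x)) (f x).
  by move=> y1 y2 y3 y4; ring.
move: A B; rewrite pq /d => {pq E E' xe sab sba box}.
move: (pd b (pd a f) p) (pd a (pd b f) x)
  (pd b (pd a f) x) => c u v A B.
have : `|u - v| < `|u - v| / 2 + `|u - v| / 2.
  by rewrite (le_lt_trans (ler_distD c _ _))// ltrD// distrC.
by rewrite -splitr ltxx.
Qed.

(** The second difference centred at a local maximum is nonpositive, while it is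
    h^2 times a second derivative taken near the maximum. *)
Lemma second_partial_at_max U (f : 'rV[R]_n -> R) a x :
  open U -> smooth_on U f -> U x -> (\forall y \near x, f y <= f x) ->
  pd a (pd a f) x <= 0.
Proof.
move=> Uo sf Ux xmax; rewrite leNgt; apply/negP => d0.
have saa : smooth_on U (pd a (pd a f)) by do 2!apply: smooth_partial.
have : \forall y \near x, [/\ U y, f y <= f x & 0 < pd a (pd a f) y].
  have UN : \forall y \near x, U y by exact: open_nbhs_nbhs.
  apply: filterS3 UN xmax (smooth_near_dist saa Ux d0) => y Uy yx.
  move=> D; apply: (And3 Uy yx); move: D.
  move: (pd a (pd a f) x) (pd a (pd a f) y) => u w.
  by rewrite ltr_norml => /andP[_ d]; lra.
move=> /nbhs_ballP[e /= e0 xe].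
pose h := e / 2; have h0 : 0 < h by rewrite divr_gt0.
set ea := delta_mx 0 a : 'rV[R]_n.
have box t : -h <= t <= h -> ball x e (t *: ea + x).
  move=> th; rewrite -ball_normE /ball_/= opprD addrCA subrr addr0 normrN normrZ.
  have th' : `|t| < e by rewrite (@le_lt_trans _ _ h)// ?ler_norml// /h; lra.
  by rewrite (le_lt_trans _ th')// ler_piMr// norm_delta_mx_le1.
have E1 s t : t *: ea + (s *: ea + (- h *: ea + x)) = (t + s - h) *: ea + x.
  by rewrite !addrA !scalerDl.
have [|s [t [sh th E]]] :=
    @mixed_difference_MVT U f a a (- h *: ea + x) h sf h0.
  move=> s t sh th; rewrite -/ea E1.
  by have [|] := xe ((t + s - h) *: ea + x); first by apply: box; lra.
move: E; rewrite -/ea !E1.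
have [|_ _ ] := xe ((t + s - h) *: ea + x); first by apply: box; lra.
have E2 : h *: ea + (- h *: ea + x) = x.
  by rewrite addrA -scalerDl subrr scale0r add0r.
rewrite !E2.
have [|_ m1 _] := xe ((h + h - h) *: ea + x); first by apply: box; lra.
have [|_ m2 _] := xe (- h *: ea + x); first by apply: box; lra.
move: m1 m2 => /[swap].
move: (pd a (pd a f) _) (f ((h + h - h) *: ea + x)).
move: (f (- h *: ea + x)) (f x) => u v w r uv rv w0 E.
have : 0 < h ^+ 2 * w by rewrite mulr_gt0// exprn_gt0.
by rewrite -E; lra.
Qed.

Lemma constant_on_ball U (f : 'rV[R]_n -> R) x (e : R) :
  smooth_on U f -> ball x e `<=` U ->
  (forall a y, U y -> pd a f y = 0) -> forall y, ball x e y -> f y = f x.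
Proof.
move=> sf xU df0 y xy.
have seg t : 0 <= t <= 1 -> U (t *: (y - x) + x).
  move=> /andP[t0 t1]; apply: xU; move: xy; rewrite -ball_normE /ball_/=.
  rewrite opprD addrCA subrr addr0 normrN normrZ (ger0_norm t0) distrC.
  by apply: le_lt_trans; rewrite ler_piMl.
have [t t1|t t1] := @MVT_line R _ f x (y - x) 1 ltr01.
  exact: smooth_derivable sf (seg t t1).
rewrite scale1r subrK derive_sum_partial; last first.
  exact: smooth_differentiable sf (seg t t1).
rewrite big1 ?mulr0; first by move/eqP; rewrite subr_eq0 => /eqP.
by move=> a _; rewrite df0 ?scaler0//; exact: seg.
Qed.

End Partials.

(** * The maximum principle and unique continuation in the plane *)

Lemma ord2P (P : 'I_2 -> Prop) : P 0 -> P 1 -> forall i, P i.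
Proof.
move=> P0 P1 [[|[|//]] i2].
- by rewrite (_ : Ordinal _ = 0)//; exact: val_inj.
- by rewrite (_ : Ordinal _ = 1)//; exact: val_inj.
Qed.

Section Plane.
Context {R : realType}.
Implicit Types (U K : set 'rV[R]_2) (x c : 'rV[R]_2).

Lemma partial_coord n (a i : 'I_n) (x : 'rV[R]_n) :
  pd a (fun z : 'rV[R]_n => z 0 i) x = (a == i)%:R.
Proof.
rewrite pdE /partial deriveE; last exact: differentiable_coord.
have @f : {linear 'rV[R]_n -> R}.
  by exists (fun N : 'rV[R]_n => N 0 i); do 2![eexists]; do ?[constructor];
     rewrite ?mxE// => ? *; rewrite ?mxE//; move=> ?; rewrite !mxE.
rewrite (_ : (fun _ => _) = f) // diff_lin; last exact: coord_continuous.
by rewrite /f /= mxE eqxx/= eq_sym.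
Qed.

Lemma smooth_coord n (U' : set 'rV[R]_n) (i : 'I_n) :
  smooth_on U' (fun z : 'rV[R]_n => z 0 i).
Proof.
case=> [|k]; first by move=> x _; exact: coord_continuous.
split=> [x _|a]; first exact: differentiable_coord.
rewrite -pdE (_ : pd _ _ = fun=> (a == i)%:R : R); first exact: Ck_on_cst.
by apply/funext => x; exact: partial_coord.
Qed.

(** The squared Euclidean distance; the norm of 'rV[R]_2 is the sup norm. *)
Definition sqdist c x : R := (x 0 0 - c 0 0) ^+ 2 + (x 0 1 - c 0 1) ^+ 2.

Lemma smooth_sub_coord n (U' : set 'rV[R]_n) (i : 'I_n) (k : R) : open U' ->
  smooth_on U' (fun z : 'rV[R]_n => z 0 i - k).
Proof.
move=> Uo; apply: smoothB => //; [exact: smooth_coord|exact: smooth_cst].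
Qed.

Lemma partial_sub_coord n (a i : 'I_n) (k : R) (x : 'rV[R]_n) :
  pd a (fun z : 'rV[R]_n => z 0 i - k) x = (a == i)%:R.
Proof.
rewrite (@partialB _ _ setT)//; last 2 first.
- exact: smooth_coord.
- exact: smooth_cst.
by rewrite partial_coord partial_cst subr0.
Qed.

Lemma smooth_sqdist U c : open U -> smooth_on U (sqdist c).
Proof.
move=> Uo; apply: smoothD => //; apply: smoothM => //; exact: smooth_sub_coord.
Qed.

Lemma partial_sqdist c a x : pd a (sqdist c) x = 2 * (x 0 a - c 0 a).
Proof.
have s i : smooth_on setT (fun z : 'rV[R]_2 => z 0 i - c 0 i).
  exact/smooth_sub_coord/openT.
rewrite (partialD a (smoothM openT (s 0) (s 0)) (smoothM openT (s 1) (s 1)))//.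
rewrite !(partialM a (s _) (s _))// !partial_sub_coord.
by move: a; apply: ord2P; rewrite /=; ring.
Qed.

Lemma partial2_sqdist c a x : pd a (pd a (sqdist c)) x = 2.
Proof.
have e : pd a (sqdist c) = fun x => 2 * (x 0 a - c 0 a).
  by apply/funext => y; exact: partial_sqdist.
rewrite e (@partialM _ _ setT)//; last 2 first.
- exact: smooth_cst.
- exact/smooth_sub_coord/openT.
by rewrite partial_cst partial_sub_coord eqxx mul0r add0r mulr1.
Qed.

Lemma sqdist_ge0 c x : 0 <= sqdist c x.
Proof. by rewrite addr_ge0// sqr_ge0. Qed.

Lemma sqdist_continuous c : continuous (sqdist c).
Proof.
by move=> x; apply: (smooth_continuous (smooth_sqdist c openT)).
Qed.

Lemma smooth_within U K (f : 'rV[R]_2 -> R) : smooth_on U f -> K `<=` U ->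
  {within K, continuous f}.
Proof.
move=> sf KU; apply: continuous_in_subspaceT => x; rewrite inE => Kx.
exact: smooth_continuous sf (KU x Kx).
Qed.

(** For e > 0 the function G + e |x|^2 has positive Laplacian, so its maximum over K
    is not attained at an interior point. *)
Lemma maximum_principle U K (G : 'rV[R]_2 -> R) (M : R) :
  open U -> smooth_on U G ->
  (forall x, U x -> 0 <= pd 0 (pd 0 G) x + pd 1 (pd 1 G) x) ->
  compact K -> K `<=` U ->
  (forall x, K x -> (\forall y \near x, K y) \/ G x <= M) ->
  forall x, K x -> G x <= M.
Proof.
move=> Uo sG sub cK KU bd x1 Kx1; rewrite leNgt; apply/negP => Mx1.
have K0 : K !=set0 by exists x1.
have sq := smooth_sqdist 0 Uo.
have [b _ bmax] := EVT_max_rV K0 cK (smooth_within sq KU).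
(* Small enough for e |x|^2 to stay below the gap G x1 - M on K. *)
pose e := (G x1 - M) / (sqdist 0 b + 1).
have e0 : 0 < e by rewrite divr_gt0 ?subr_gt0// ltr_wpDl// sqdist_ge0.
pose H x := G x + e * sqdist 0 x.
have seq : smooth_on U (fun x => e * sqdist 0 x).
  by apply: smoothM => //; exact: smooth_cst.
have sH : smooth_on U H by exact: smoothD.
have [x0 + Hmax] := EVT_max_rV K0 cK (smooth_within sH KU).
rewrite inE => Kx0.
have HK y : K y -> H y <= H x0 by move=> Ky; apply: Hmax; rewrite inE.
have [nK|Gx0] := bd x0 Kx0.
  have Ux0 := KU _ Kx0.
  have pH a : pd a (pd a H) x0 = pd a (pd a G) x0 + e * 2.
    have E1 y : U y -> pd a H y =
        pd a G y + e * pd a (sqdist 0) y.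
      move=> Uy; rewrite (partialD a sG seq)//; congr (_ + _).
      rewrite (partialM a _ sq Uy); last exact: smooth_cst.
      by rewrite partial_cst mul0r add0r.
    rewrite (partial_ext a Uo E1 Ux0).
    have ss := smooth_partial a sq.
    have sc : smooth_on U (fun=> e) by exact: smooth_cst.
    rewrite (partialD a (smooth_partial a sG) (smoothM Uo sc ss))//.
    by rewrite (partialM a sc ss Ux0) partial_cst mul0r add0r partial2_sqdist.
  have h a : pd a (pd a G) x0 + e * 2 <= 0.
    rewrite -pH; apply: second_partial_at_max Uo sH Ux0 _.
    by apply: filterS nK => y; exact: HK.
  have := sub x0 Ux0; have := h 0; have := h 1.
  move: (pd 0 _ _) (pd 1 _ _) => u v; lra.
have := HK x1 Kx1; rewrite /H => h1.
have h2 : sqdist 0 x0 <= sqdist 0 b by apply: bmax; rewrite inE.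
have h3 := sqdist_ge0 0 x1.
have h4 : e * (sqdist 0 b + 1) = G x1 - M.
  by rewrite divfK// gt_eqF// ltr_wpDl// sqdist_ge0.
have h5 : e * sqdist 0 x0 <= e * sqdist 0 b by rewrite ler_pM2l.
have h6 : 0 <= e * sqdist 0 x1 by rewrite mulr_ge0// ltW.
by move: h1 h4 h5 h6; rewrite mulrDr; lra.
Qed.

End Plane.

Section UniqueContinuation.
Context {R : realType}.
Implicit Types (U K : set 'rV[R]_2) (x c : 'rV[R]_2).

(** These are the Cauchy-Riemann equations for A - iB; the gradient of a harmonic
    function is of this form. *)
Definition harmonic_field U (A B : 'rV[R]_2 -> R) : Prop :=
  [/\ smooth_on U A, smooth_on U B,
   forall x, U x -> pd 0 A x + pd 1 B x = 0 &
   forall x, U x -> pd 1 A x = pd 0 B x].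

(** The product of A - iB and P - iQ. *)
Lemma harmonic_fieldM U A B P Q : open U ->
  harmonic_field U A B -> harmonic_field U P Q ->
  harmonic_field U (fun x => A x * P x - B x * Q x)
    (fun x => A x * Q x + B x * P x).
Proof.
move=> Uo [sA sB dAB cAB] [sP sQ dPQ cPQ].
have s1 := smoothM Uo sA sP; have s2 := smoothM Uo sB sQ.
have s3 := smoothM Uo sA sQ; have s4 := smoothM Uo sB sP.
have div0 (F G : 'rV[R]_2 -> R) : (forall x, U x -> pd 0 F x + pd 1 G x = 0) ->
    forall x, U x -> pd 0 F x = - pd 1 G x.
  by move=> d x Ux; apply/eqP; rewrite -addr_eq0 d.
split; [exact: smoothB|exact: smoothD|..] => x Ux;
  rewrite (partialB _ s1 s2 Ux) (partialD _ s3 s4 Ux);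
  rewrite !(partialM _ sA _ Ux)// !(partialM _ sB _ Ux)//;
  by rewrite (div0 _ _ dAB x Ux) (div0 _ _ dPQ x Ux) (cAB x Ux) (cPQ x Ux); ring.
Qed.

Lemma harmonic_fieldB U A B P Q : open U ->
  harmonic_field U A B -> harmonic_field U P Q ->
  harmonic_field U (fun x => A x - P x) (fun x => B x - Q x).
Proof.
move=> Uo [sA sB dAB cAB] [sP sQ dPQ cPQ].
split; [exact: smoothB|exact: smoothB|..] => x Ux.
  rewrite (partialB _ sA sP Ux) (partialB _ sB sQ Ux) addrACA -opprD.
  by rewrite dAB// dPQ// subr0.
by rewrite (partialB _ sA sP Ux) (partialB _ sB sQ Ux) cAB// cPQ.
Qed.

Lemma partialV_sqdist U c a x : open U -> U x -> sqdist c x != 0 ->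
  pd a (fun x => (sqdist c x)^-1) x =
  - (2 * (x 0 a - c 0 a) / sqdist c x ^+ 2).
Proof.
by move=> Uo Ux d0; rewrite (partialV a (smooth_sqdist c Uo))// partial_sqdist.
Qed.

(** The holomorphic function 1 / (z - c). *)
Lemma harmonic_field_pole U c : open U -> (forall x, U x -> sqdist c x != 0) ->
  harmonic_field U (fun x => (x 0 0 - c 0 0) * (sqdist c x)^-1)
                   (fun x => (x 0 1 - c 0 1) * (sqdist c x)^-1).
Proof.
move=> Uo d0.
have sV := smoothV Uo (smooth_sqdist c Uo) d0.
have sc i : smooth_on U (fun x => x 0 i - c 0 i) by exact: smooth_sub_coord.
have dx i a x : U x -> pd a (fun x => (x 0 i - c 0 i) * (sqdist c x)^-1) x =
    (a == i)%:R / sqdist c x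
    - (x 0 i - c 0 i) * (2 * (x 0 a - c 0 a) / sqdist c x ^+ 2).
  move=> Ux; rewrite (partialM a (sc i) sV Ux) partial_sub_coord.
  by rewrite (partialV_sqdist a Uo Ux (d0 x Ux)) mulrN.
split; [exact: smoothM|exact: smoothM|..] => x Ux; rewrite !dx//=.
  have := d0 x Ux; rewrite /sqdist.
  move: (x 0 0 - c 0 0) (x 0 1 - c 0 1) => u v uv0; by field.
ring.
Qed.

(** The Laplacian of |f|^2 is 4 |f'|^2 when f is holomorphic. *)
Lemma harmonic_field_sqr_subharmonic U A B : open U -> harmonic_field U A B ->
  forall x, U x ->
    0 <= pd 0 (pd 0 (fun x => A x * A x + B x * B x)) x
       + pd 1 (pd 1 (fun x => A x * A x + B x * B x)) x.
Proof.
move=> Uo [sA sB dAB cAB] x Ux.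
have d2 a : pd a (pd a (fun x => A x * A x + B x * B x)) x =
    2 * (pd a A x ^+ 2 + pd a B x ^+ 2
         + A x * pd a (pd a A) x + B x * pd a (pd a B) x).
  have E y : U y -> pd a (fun x => A x * A x + B x * B x) y =
      (A y * pd a A y + B y * pd a B y)
      + (A y * pd a A y + B y * pd a B y).
    move=> Uy; rewrite (partialD a (smoothM Uo sA sA) (smoothM Uo sB sB) Uy).
    by rewrite (partialM a sA sA Uy) (partialM a sB sB Uy); ring.
  have spA := smooth_partial a sA; have spB := smooth_partial a sB.
  have s1 := smoothM Uo sA spA; have s2 := smoothM Uo sB spB.
  have s3 := smoothD Uo s1 s2.
  rewrite (partial_ext a Uo E Ux) (partialD a s3 s3 Ux) (partialD a s1 s2 Ux).
  by rewrite (partialM a sA spA Ux) (partialM a sB spB Ux); ring.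
have dAB' y : U y -> pd 0 A y = - 1 * pd 1 B y.
  by move=> Uy; apply/eqP; rewrite mulN1r -addr_eq0 dAB.
have dAB2 y : U y -> pd 1 B y = - 1 * pd 0 A y.
  by move=> Uy; rewrite dAB'// mulrA mulrNN !mul1r.
have pN a b (f : 'rV[R]_2 -> R) : smooth_on U f ->
    pd a (fun y => - 1 * pd b f y) x = - pd a (pd b f) x.
  move=> sf; have s1 : smooth_on U (fun=> -1 : R) by exact: smooth_cst.
  rewrite (partialM a s1 (smooth_partial b sf) Ux).
  by rewrite partial_cst mul0r add0r mulN1r.
have lA : pd 0 (pd 0 A) x + pd 1 (pd 1 A) x = 0.
  rewrite (partial_ext 0 Uo dAB' Ux) (partial_ext 1 Uo cAB Ux) pN//.
  by rewrite (partialC 0 1 Uo sB Ux) addNr.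
have lB : pd 0 (pd 0 B) x + pd 1 (pd 1 B) x = 0.
  rewrite -(partial_ext 0 Uo cAB Ux) (partial_ext 1 Uo dAB2 Ux) pN//.
  by rewrite (partialC 0 1 Uo sA Ux) addrN.
have gen (u v p0 q0 p1 q1 r0 s0 r1 s1 : R) : r0 + r1 = 0 -> s0 + s1 = 0 ->
    0 <= 2 * (p0 ^+ 2 + q0 ^+ 2 + u * r0 + v * s0)
       + 2 * (p1 ^+ 2 + q1 ^+ 2 + u * r1 + v * s1).
  move=> /eqP; rewrite addr_eq0 => /eqP -> /eqP; rewrite addr_eq0 => /eqP ->.
  set w := (w in _ <= w).
  have -> : w = 2 * (p0 ^+ 2 + q0 ^+ 2 + p1 ^+ 2 + q1 ^+ 2) by rewrite /w; ring.
  by rewrite mulr_ge0// !addr_ge0// sqr_ge0.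
by rewrite !d2; exact: gen lA lB.
Qed.

Lemma sqdist_ball (e : R) x c : 0 < e -> sqdist c x < e ^+ 2 -> ball c e x.
Proof.
move=> e0; rewrite /sqdist -ball_normE /ball_/= distrC => xc.
have small (u v : R) : u ^+ 2 + v ^+ 2 < e ^+ 2 -> `|u| < e /\ `|v| < e.
  by move=> uv; split; rewrite -(ltr_pXn2r (ltn0Sn 1))// ?nnegrE ?ltW//
    real_normK ?num_real//; apply: le_lt_trans uv; rewrite ?lerDl ?lerDr sqr_ge0.
have [h0 h1] := small _ _ xc.
rewrite [ltLHS]/Num.Def.normr/= mx_normrE; apply: bigmax_lt => // -[i j] _ /=.
by rewrite !mxE (ord1 i); move: j; apply: ord2P.
Qed.

Lemma ball_sqdist (d : R) x c : ball c d x -> sqdist c x < 2 * d ^+ 2.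
Proof.
rewrite -ball_normE /ball_/= => xc.
have d0 : 0 <= d by rewrite (le_trans _ (ltW xc)).
have h i : (x 0 i - c 0 i) ^+ 2 < d ^+ 2.
  rewrite -real_normK ?num_real// ltr_pXn2r ?nnegrE// distrC.
  apply: le_lt_trans xc; rewrite [leRHS]/Num.Def.normr/= mx_normrE.
  by apply: le_trans; last exact: (le_bigmax _ _ (0, i)); rewrite !mxE.
by rewrite /sqdist mulr_natl mulr2n ltrD// h.
Qed.

Definition annulus c (s t : R) := [set x | s <= sqdist c x <= t].

Lemma annulus_compact c (s r : R) (r0 : 0 < r) : compact (annulus c s (r ^+ 2)).
Proof.
apply: bounded_closed_compact.
  exists (r + 1 + `|c|); split; first exact: num_real.
  move=> M rM x /andP[_ xr] /=; rewrite (le_trans _ (ltW rM))//.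
  have /ltW : `|c - x| < r + 1.
    have /sqdist_ball : sqdist c x < (r + 1) ^+ 2.
      by rewrite (le_lt_trans xr)// ltr_pXn2r ?nnegrE ?ltrDl ?ltW ?addr_gt0.
    by rewrite -ball_normE; apply; rewrite addr_gt0.
  rewrite -[in `|x|](subKr c x) => h.
  by rewrite (le_trans (ler_normB _ _))// addrC lerD2r.
rewrite (_ : annulus _ _ _ = sqdist c @^-1` `[s, r ^+ 2]%classic).
  apply: preimage_closed => [x _|]; last exact: interval_closed.
  exact: sqdist_continuous.
by apply/seteqP; split=> x; rewrite /annulus /= in_itv.
Qed.

Lemma annulus_nbhs c x (s t : R) : s < sqdist c x < t ->
  \forall y \near x, annulus c s t y.
Proof.
move=> /andP[sx xt].
have h1 : \forall y \near x, s < sqdist c y.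
  by have := sqdist_continuous (c := c) (x := x); move=> /cvgr_gt; apply.
have h2 : \forall y \near x, sqdist c y < t.
  by have := sqdist_continuous (c := c) (x := x); move=> /cvgr_lt; apply.
by apply: filterS2 h1 h2 => y h1 h2; rewrite /annulus/= !ltW.
Qed.

(** A holomorphic f that vanishes near c vanishes on every disc around c in U. For
    each m the quotient f / (z - c)^m is holomorphic on an annulus whose inner
    circle lies in the zero set of f, so by the maximum principle
    |f (x)|^2 <= M (|x - c| / r)^(2 m), where M bounds |f|^2; let m grow. *)
Lemma harmonic_field_continuation U A B c (r e : R) :
  open U -> harmonic_field U A B ->
  0 < r -> (forall x, sqdist c x <= r ^+ 2 -> U x) ->
  0 < e -> (forall x, sqdist c x < e ^+ 2 -> A x = 0 /\ B x = 0) ->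
  forall x, sqdist c x < r ^+ 2 -> A x = 0 /\ B x = 0.
Proof.
move=> Uo hAB r0 rU e0 AB0 x xr.
have [xe|xe] := ltP (sqdist c x) (e ^+ 2); first exact: AB0.
pose s := e ^+ 2 / 2; have s0 : 0 < s by rewrite divr_gt0// exprn_gt0.
have se : s < e ^+ 2 by rewrite /s; have := exprn_gt0 2 e0; lra.
pose K := annulus c s (r ^+ 2).
have Kx : K x by rewrite /K /annulus/= (ltW xr) andbT (le_trans (ltW se)).
have cK : compact K := @annulus_compact c s r r0.
pose U' := U `&` [set x | 0 < sqdist c x].
have U'o : open U'.
  apply: openI => //; rewrite (_ : mkset _ = sqdist c @^-1` `]0, +oo[%classic).
    apply: open_comp; last exact: interval_open.
    by move=> y _; exact: sqdist_continuous.
  by apply/seteqP; split=> y; rewrite /= in_itv/= andbT.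
have KU' : K `<=` U'.
  move=> y /andP[sy yr]; split; first exact: rU.
  exact: lt_le_trans sy.
have d0 y : U' y -> sqdist c y != 0 by move=> [_ /lt0r_neq0].
pose T P Q := (fun y => P y * P y + Q y * Q y) : 'rV[R]_2 -> R.
pose Bd m y : R := T A B y * (sqdist c y)^-1 ^+ m.
have hk m : exists P Q, harmonic_field U' P Q /\ forall y, U' y -> T P Q y = Bd m y.
  elim: m => [|m [P [Q [hPQ TPQ]]]].
    exists A, B; split; last by move=> y _; rewrite /Bd expr0 mulr1.
    have UU : U' `<=` U by move=> y [].
    by case: hAB => hA hB dAB cAB; split=> [||y /UU|y /UU];
      [exact: smooth_sub hA|exact: smooth_sub hB|exact: dAB|exact: cAB].
  exists (fun y => P y * ((y 0 0 - c 0 0) * (sqdist c y)^-1)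
                   - Q y * ((y 0 1 - c 0 1) * (sqdist c y)^-1)).
  exists (fun y => P y * ((y 0 1 - c 0 1) * (sqdist c y)^-1)
                   + Q y * ((y 0 0 - c 0 0) * (sqdist c y)^-1)).
  split; first exact: harmonic_fieldM U'o hPQ (harmonic_field_pole U'o d0).
  move=> y Uy; rewrite /Bd exprSr mulrA -/(Bd m y) -(TPQ y Uy) /T.
  have := d0 y Uy; rewrite /sqdist.
  move: (y 0 0 - c 0 0) (y 0 1 - c 0 1) (P y) (Q y) => u v p q uv0.
  by field.
have K0 : K !=set0 by exists x.
have [hA hB _ _] := hAB.
have sT : smooth_on U (T A B) by apply: smoothD => //; exact: smoothM.
have KU : K `<=` U by move=> y /KU' [].
have [b _ bmax] := EVT_max_rV K0 cK (smooth_within sT KU).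
set M := T A B b in bmax.
have M0 : 0 <= M by rewrite /M /T addr_ge0// sqr_ge0.
have bound m : Bd m x <= M * (r ^+ 2)^-1 ^+ m.
  have [P [Q [hPQ TPQ]]] := hk m.
  rewrite -TPQ; last exact: KU'.
  have [hP hQ _ _] := hPQ.
  have sPQ : smooth_on U' (T P Q) by apply: smoothD => //; exact: smoothM.
  apply: (maximum_principle U'o sPQ _ cK KU' _ Kx).
    exact: harmonic_field_sqr_subharmonic.
  move=> y Ky; have /andP[] := Ky.
  rewrite le_eqVlt => /orP[/eqP sy _|sy].
    right; rewrite TPQ; last exact: KU'.
    have [|Ay By] := AB0 y; first by rewrite -sy.
    by rewrite /Bd /T Ay By !mulr0 addr0 mul0r mulr_ge0// exprn_ge0// invr_ge0 sqr_ge0.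
  rewrite le_eqVlt => /orP[/eqP yr|yr]; last first.
    by left; apply: annulus_nbhs; rewrite sy yr.
  right; rewrite TPQ; last exact: KU'.
  rewrite /Bd yr ler_wpM2r ?exprn_ge0 ?invr_ge0 ?sqr_ge0//.
  by apply: bmax; rewrite inE.
have x0 : 0 < sqdist c x by have [] := KU' _ Kx.
have bound' m : T A B x <= M * (sqdist c x / r ^+ 2) ^+ m.
  have := bound m; rewrite /Bd expr_div_n [_ ^+ m * _]mulrC exprVn.
  by rewrite ler_pdivrMr ?exprn_gt0// mulrA exprVn.
have Tx : T A B x <= 0.
  rewrite leNgt; apply/negP => T0.
  have t1 : `|sqdist c x / r ^+ 2| < 1.
    by rewrite ger0_norm ?divr_ge0 ?sqr_ge0 ?sqdist_ge0// ltr_pdivrMr ?exprn_gt0// mul1r.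
  have /cvgr_lt /(_ _ T0) [N _ HN] := cvg_geometric M t1.
  by have := HN N (leqnn N); rewrite /= ltNge bound'.
have := Tx; rewrite /T -!expr2 => h.
have : A x ^+ 2 + B x ^+ 2 == 0 by rewrite eq_le h addr_ge0// sqr_ge0.
by rewrite paddr_eq0 ?sqr_ge0// !sqrf_eq0 => /andP[/eqP -> /eqP ->].
Qed.

End UniqueContinuation.

(** * Vector algebra and vector calculus in R^3 *)

Section Vectors.
Context {R : realType}.
Implicit Types (x y z : 'rV[R]_3) (a b : R).

Lemma ord3P (P : 'I_3 -> Prop) : P 0 -> P 1 -> P 2 -> forall i, P i.
Proof.
move=> P0 P1 P2 [[|[|[|//]]] i3].
- by rewrite (_ : Ordinal _ = 0)//; exact: val_inj.
- by rewrite (_ : Ordinal _ = 1)//; exact: val_inj.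
- by rewrite (_ : Ordinal _ = 2)//; exact: val_inj.
Qed.

Lemma sum3E (V : nmodType) (f : 'I_3 -> V) : \sum_i f i = f 0 + f 1 + f 2.
Proof.
rewrite !big_ord_recl big_ord0 addr0 addrA.
by congr (_ + f _ + f _); exact: val_inj.
Qed.

Lemma dotE x y : dot x y = x 0 0 * y 0 0 + x 0 1 * y 0 1 + x 0 2 * y 0 2.
Proof. exact: sum3E. Qed.

Lemma cross0E x y : cross x y 0 0 = x 0 1 * y 0 2 - x 0 2 * y 0 1.
Proof. by rewrite mxE !add0r. Qed.

Lemma cross1E x y : cross x y 0 1 = x 0 2 * y 0 0 - x 0 0 * y 0 2.
Proof.
have e : 1 + 2 = 0 :> 'I_3 by exact: val_inj.
by rewrite mxE e.
Qed.

Lemma cross2E x y : cross x y 0 2 = x 0 0 * y 0 1 - x 0 1 * y 0 0.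
Proof.
have e1 : 2 + 1 = 0 :> 'I_3 by exact: val_inj.
have e2 : 2 + 2 = 1 :> 'I_3 by exact: val_inj.
by rewrite mxE e1 e2.
Qed.

Lemma rV3P x y : x 0 0 = y 0 0 -> x 0 1 = y 0 1 -> x 0 2 = y 0 2 -> x = y.
Proof. by move=> h0 h1 h2; apply/rowP; exact: ord3P. Qed.

Definition vecE := (dotE, cross0E, cross1E, cross2E, mxE).

Lemma dotC x y : dot x y = dot y x.
Proof. by rewrite !dotE; ring. Qed.

Lemma dotDl x y z : dot (x + y) z = dot x z + dot y z.
Proof. by rewrite !vecE; ring. Qed.

Lemma dotDr x y z : dot x (y + z) = dot x y + dot x z.
Proof. by rewrite !vecE; ring. Qed.

Lemma dotZl a x y : dot (a *: x) y = a * dot x y.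
Proof. by rewrite !vecE; ring. Qed.

Lemma dotZr a x y : dot x (a *: y) = a * dot x y.
Proof. by rewrite !vecE; ring. Qed.

Lemma dotNl x y : dot (- x) y = - dot x y.
Proof. by rewrite !vecE; ring. Qed.

Lemma dotNr x y : dot x (- y) = - dot x y.
Proof. by rewrite !vecE; ring. Qed.

Lemma dot0l x : dot 0 x = 0.
Proof. by rewrite !vecE; ring. Qed.

Lemma dot0r x : dot x 0 = 0.
Proof. by rewrite !vecE; ring. Qed.

Lemma dotxx_ge0 x : 0 <= dot x x.
Proof. by rewrite dotE -!expr2 !addr_ge0// sqr_ge0. Qed.

Lemma dotxx_eq0 x : (dot x x == 0) = (x == 0).
Proof.
apply/eqP/eqP => [|->]; last exact: dot0l.
rewrite dotE -!expr2 => /eqP.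
rewrite paddr_eq0 ?addr_ge0 ?sqr_ge0// paddr_eq0 ?sqr_ge0// !sqrf_eq0.
by move=> /andP[/andP[/eqP h0 /eqP h1] /eqP h2]; apply: rV3P; rewrite mxE.
Qed.

Lemma dotxx_gt0 x : (0 < dot x x) = (x != 0).
Proof. by rewrite lt_neqAle dotxx_ge0 andbT eq_sym dotxx_eq0. Qed.

End Vectors.

Section VectorCalculus.
Context {R : realType} {n : nat}.
Implicit Types (U : set 'rV[R]_n) (a : 'I_n) (z : 'rV[R]_n).
Implicit Types (F G : 'rV[R]_n -> 'rV[R]_3) (f : 'rV[R]_n -> R).

Lemma partial_vec U F a k z : smooth_on U F -> U z ->
  pd a F z 0 k = pd a (fun z => F z 0 k) z.
Proof.
move=> sF Uz.
have dF : derivable F z (delta_mx 0 a) by exact: (smooth_derivable sF Uz).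
by rewrite !pdE /partial derive_mx// mxE.
Qed.

Lemma smooth_vec_coord U F k : open U -> smooth_on U F ->
  smooth_on U (fun z => F z 0 k).
Proof.
move=> Uo sF m; elim: m F sF => [|m IH] F sF.
  move=> x Ux; apply: (@continuous_comp _ _ _ F (fun v : 'rV[R]_3 => v 0 k)).
    exact: smooth_continuous sF Ux.
  exact: coord_continuous.
split=> [x Ux|a].
  apply: (@differentiable_comp _ _ _ _ F (fun v : 'rV[R]_3 => v 0 k)).
    exact: smooth_differentiable sF Ux.
  exact: differentiable_coord.
apply: (Ck_on_ext Uo _ (IH _ (smooth_partial a sF))) => y Uy.
by rewrite -pdE; exact: partial_vec sF Uy.
Qed.

Lemma smooth_scale_cst U f (w : 'rV[R]_3) : open U -> smooth_on U f ->
  smooth_on U (fun z => f z *: w).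
Proof.
move=> Uo sf m; elim: m f sf => [|m IH] f sf.
  move=> x Ux; apply: continuousZr_tmp; exact: smooth_continuous sf Ux.
have df x : U x -> differentiable f x by exact: smooth_differentiable.
split=> [x Ux|a]; first by apply: differentiableZl; exact: df.
apply: (Ck_on_ext Uo _ (IH _ (smooth_partial a sf))) => y Uy.
have dfw : differentiable (fun z => f z *: w) y by apply: differentiableZl; exact: df.
by rewrite pdE /partial !deriveE ?diffZl//; exact: df.
Qed.

Lemma smooth_vec U F : open U -> (forall k, smooth_on U (fun z => F z 0 k)) ->
  smooth_on U F.
Proof.
move=> Uo sF.
apply: (@smooth_ext _ _ _ U (fun z => \sum_k F z 0 k *: delta_mx 0 k)) => //.
  by move=> y _; rewrite [RHS]row_sum_delta.
move=> m; apply: Ck_on_sum => // k; exact: smooth_scale_cst.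
Qed.

Lemma smooth_dot U F G : open U -> smooth_on U F -> smooth_on U G ->
  smooth_on U (fun z => dot (F z) (G z)).
Proof.
move=> Uo sF sG m; apply: Ck_on_sum => // k.
apply: Ck_onM => //; exact: smooth_vec_coord.
Qed.

Lemma partial_dot U F G a z : open U -> smooth_on U F -> smooth_on U G -> U z ->
  pd a (fun z => dot (F z) (G z)) z =
  dot (pd a F z) (G z) + dot (F z) (pd a G z).
Proof.
move=> Uo sF sG Uz.
have e : (fun z => dot (F z) (G z)) = fun z =>
  F z 0 0 * G z 0 0 + F z 0 1 * G z 0 1 + F z 0 2 * G z 0 2.
  by apply/funext => y; rewrite dotE.
have sc (H : 'rV[R]_n -> 'rV[R]_3) k : smooth_on U H -> smooth_on U (fun z => H z 0 k).
  exact: smooth_vec_coord.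
have s k : smooth_on U (fun z => F z 0 k * G z 0 k) by apply: smoothM; auto.
rewrite e (partialD a (smoothD Uo (s 0) (s 1)) (s 2) Uz).
rewrite (partialD a (s 0) (s 1) Uz) !(partialM a (sc _ _ sF) (sc _ _ sG) Uz).
rewrite -!(partial_vec _ _ sF Uz) -!(partial_vec _ _ sG Uz) !dotE.
by ring.
Qed.

Lemma smooth_cross U F G : open U -> smooth_on U F -> smooth_on U G ->
  smooth_on U (fun z => cross (F z) (G z)).
Proof.
move=> Uo sF sG; apply: smooth_vec => // k.
have sc (H : 'rV[R]_n -> 'rV[R]_3) i : smooth_on U H -> smooth_on U (fun z => H z 0 i).
  exact: smooth_vec_coord.
have : smooth_on U (fun z => F z 0 (k + 1) * G z 0 (k + 2)
                             - F z 0 (k + 2) * G z 0 (k + 1)).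
  by apply: smoothB => //; apply: smoothM; auto.
by apply: smooth_ext => // y _; rewrite mxE.
Qed.

Lemma smooth_scale U f F : open U -> smooth_on U f -> smooth_on U F ->
  smooth_on U (fun z => f z *: F z).
Proof.
move=> Uo sf sF; apply: smooth_vec => // k.
have : smooth_on U (fun z => f z * F z 0 k).
  by apply: smoothM => //; exact: smooth_vec_coord.
by apply: smooth_ext => // y _; rewrite mxE.
Qed.

Lemma partial_scale U f F a z : open U -> smooth_on U f -> smooth_on U F -> U z ->
  pd a (fun z => f z *: F z) z =
  pd a f z *: F z + f z *: pd a F z.
Proof.
move=> Uo sf sF Uz; apply/rowP => k.
rewrite (partial_vec _ _ (smooth_scale Uo sf sF) Uz).
have e : (fun z => (f z *: F z) 0 k) = fun z => f z * F z 0 k.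
  by apply/funext => y; rewrite mxE.
rewrite e (partialM a sf (smooth_vec_coord k Uo sF) Uz).
by rewrite -(partial_vec _ _ sF Uz) !mxE.
Qed.

Lemma partialC_vec U F a b z : open U -> smooth_on U F -> U z ->
  pd a (pd b F) z = pd b (pd a F) z.
Proof.
move=> Uo sF Uz; apply/rowP => k.
have sc := smooth_vec_coord k Uo sF.
apply: (etrans (partial_vec a k (smooth_partial b sF) Uz)).
apply: (etrans _ (esym (partial_vec b k (smooth_partial a sF) Uz))).
have E c y : U y -> pd c F y 0 k = pd c (fun z => F z 0 k) y.
  by move=> Uy; exact: partial_vec sF Uy.
apply: (etrans (partial_ext a Uo (E b) Uz)).
apply: (etrans (partialC a b Uo sc Uz)).
exact: esym (partial_ext b Uo (E a) Uz).
Qed.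

End VectorCalculus.

Section Frames.
Context {R : realType}.
Implicit Types (x y z w n e f : 'rV[R]_3) (a b : R).

Lemma dotBl x y z : dot (x - y) z = dot x z - dot y z.
Proof. by rewrite dotDl dotNl. Qed.

Lemma dotBr x y z : dot x (y - z) = dot x y - dot x z.
Proof. by rewrite dotDr dotNr. Qed.

Lemma triple_rot x y z : dot x (cross y z) = dot y (cross z x).
Proof. by rewrite !vecE; ring. Qed.

Lemma crossC x y : cross x y = - cross y x.
Proof. by apply: rV3P; rewrite !vecE; ring. Qed.

Lemma dot_crossl x y : dot x (cross x y) = 0.
Proof. by rewrite !vecE; ring. Qed.

Lemma dot_crossr x y : dot x (cross y x) = 0.
Proof. by rewrite !vecE; ring. Qed.

Lemma double_cross x y z : cross x (cross y z) = dot x z *: y - dot x y *: z.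
Proof. by apply: rV3P; rewrite !vecE; ring. Qed.

Lemma dot_cross_cross x y z w :
  dot (cross x y) (cross z w) = dot x z * dot y w - dot x w * dot y z.
Proof. by rewrite !vecE; ring. Qed.

Lemma cramer3 x y z w : dot x (cross y z) *: w =
  dot w x *: cross y z + dot w y *: cross z x + dot w z *: cross x y.
Proof. by apply: rV3P; rewrite !vecE; ring. Qed.

(** The conditions make e, n x e, n an orthogonal basis in which n x e has the
    length of e. *)
Definition orthogonal_frame n e := [/\ dot n n = 1, dot n e = 0 & 0 < dot e e].

Lemma frame_eq n e x y : orthogonal_frame n e ->
  dot x e = dot y e -> dot x (cross n e) = dot y (cross n e) ->
  dot x n = dot y n -> x = y.
Proof.
move=> [nn ne ee] h1 h2 h3; apply/subr0_eq.
have d0 : dot e (cross (cross n e) n) = dot e e.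
  by rewrite triple_rot dot_cross_cross nn ne mul1r mul0r subr0.
have : dot e (cross (cross n e) n) *: (x - y) = 0.
  by rewrite cramer3 !dotBl h1 h2 h3 !subrr !scale0r !addr0.
by move/eqP; rewrite d0 scaler_eq0 gt_eqF//= => /eqP.
Qed.

Lemma frame_expand n e w : orthogonal_frame n e ->
  dot e e *: w = dot w e *: e + dot w (cross n e) *: cross n e
                 + (dot e e * dot w n) *: n.
Proof.
move=> [nn ne _].
have e1 : cross (cross n e) n = e.
  by rewrite crossC double_cross nn ne scale0r sub0r scale1r opprK.
have e2 : cross e (cross n e) = dot e e *: n.
  by rewrite double_cross [dot e n]dotC ne scale0r subr0.
have := cramer3 e (cross n e) n w; rewrite e1 e2 scalerA => ->.
by rewrite [dot w n * _]mulrC.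
Qed.

(** Here p and q are the images of e and f under a symmetric operator A of trace
    2t on the plane orthogonal to n. The trace-free part of A anticommutes with
    the rotation J w = n x w, so it cancels in A - J A J, which is 2t. *)
Lemma frame_trace n e f p q t : orthogonal_frame n e -> f = cross n e ->
  dot p n = 0 -> dot q n = 0 -> dot p f = dot q e ->
  dot p e + dot q f = 2 * t * dot e e ->
  p = (2 * t) *: e + cross n q /\ q = (2 * t) *: f - cross n p.
Proof.
move=> nef -> pn qn pf pe; have [nn ne ee] := nef.
have ef : dot e (cross n e) = 0 by rewrite dot_crossr.
have cr w : dot (cross n w) e = - dot w (cross n e).
  by rewrite dotC triple_rot triple_rot crossC dotNr.
have cf w : dot w n = 0 -> dot (cross n w) (cross n e) = dot w e.
  by move=> wn; rewrite dot_cross_cross nn ne mul0r subr0 mul1r.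
have cn w : dot (cross n w) n = 0 by rewrite dotC dot_crossl.
split; apply: (frame_eq nef); rewrite dotDl ?dotNl dotZl.
- by rewrite cr -pe; ring.
- by rewrite ef cf// pf; ring.
- by rewrite pn cn [dot e n]dotC ne; ring.
- by rewrite [dot (cross n e) e]dotC ef cr -pf; ring.
- rewrite (cf p pn) (cf e (etrans (dotC _ _) ne)); move: pe; move: (dot p e) (dot q _) => u v.
  by move=> /(canRL (addKr _)) ->; ring.
- by rewrite qn cn [dot _ n]dotC dot_crossl; ring.
Qed.

End Frames.

(** * Conformal minimal patches *)

(** The last clause is minimality: the normal part of the Euclidean Laplacian of
    F is - 2 |F_u|^2 <F, N> / |F|^2. *)
Definition minimal_patch {R : realType} (U : set 'rV[R]_2)
    (F N : 'rV[R]_2 -> 'rV[R]_3) : Prop :=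
  [/\ smooth_on U F, smooth_on U N & forall z, U z ->
    [/\ F z != 0, orthogonal_frame (N z) (pd 0 F z),
        pd 1 F z = cross (N z) (pd 0 F z) &
        dot (N z) (pd 0 (pd 0 F) z + pd 1 (pd 1 F) z)
          * dot (F z) (F z)
        = - 2 * dot (pd 0 F z) (pd 0 F z) * dot (F z) (N z)]].

(** Minus the Euclidean mean curvature of a minimal patch. *)
Definition tilt {R : realType} (F N : 'rV[R]_2 -> 'rV[R]_3) z : R :=
  dot (F z) (N z) / dot (F z) (F z).

Section MinimalPatch.
Context {R : realType} (U : set 'rV[R]_2) (F N : 'rV[R]_2 -> 'rV[R]_3).
Hypothesis Uo : open U.
Hypothesis patch : minimal_patch U F N.

Local Notation Fu := (pd 0 F).
Local Notation Fv := (pd 1 F).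
Local Notation Nu := (pd 0 N).
Local Notation Nv := (pd 1 N).

Let sF : smooth_on U F. Proof. by case: patch. Qed.
Let sN : smooth_on U N. Proof. by case: patch. Qed.
Let frame z : U z -> orthogonal_frame (N z) (Fu z).
Proof. by case: patch => _ _ p /p[]. Qed.
Let FvE z : U z -> Fv z = cross (N z) (Fu z).
Proof. by case: patch => _ _ p /p[]. Qed.

Lemma patch_neq0 z : U z -> dot (F z) (F z) != 0.
Proof. by case: patch => _ _ p /p[F0 _ _ _]; rewrite dotxx_eq0. Qed.

Lemma patch_normal a z : U z -> dot (N z) (pd a F z) = 0.
Proof.
move=> Uz; have [_ ne _] := frame Uz.
by move: a; apply: ord2P => //; rewrite FvE// dot_crossl.
Qed.

Lemma patch_unit z : U z -> dot (N z) (N z) = 1.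
Proof. by move=> /frame[]. Qed.

Lemma patch_eq z x y : U z -> (forall a, dot x (pd a F z) = dot y (pd a F z)) ->
  dot x (N z) = dot y (N z) -> x = y.
Proof.
move=> Uz xy; apply: (frame_eq (frame Uz)); first exact: xy.
by rewrite -FvE.
Qed.

Lemma patch_conformal z : U z ->
  dot (Fv z) (Fv z) = dot (Fu z) (Fu z) /\ dot (Fu z) (Fv z) = 0.
Proof.
move=> Uz; rewrite FvE// dot_cross_cross dot_crossr.
by have [-> -> _] := frame Uz; rewrite mul1r mul0r subr0.
Qed.

Lemma dot_cst_derive a (P Q : 'rV[R]_2 -> 'rV[R]_3) (c : R) z :
  smooth_on U P -> smooth_on U Q -> U z ->
  (forall y, U y -> dot (P y) (Q y) = c) ->
  dot (pd a P z) (Q z) = - dot (P z) (pd a Q z).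
Proof.
move=> sP sQ Uz PQ; apply/eqP; rewrite -addr_eq0; apply/eqP.
rewrite -(partial_dot a Uo sP sQ Uz).
by rewrite (partial_ext a Uo PQ Uz) partial_cst.
Qed.

Lemma patch_dN_normal a z : U z -> dot (pd a N z) (N z) = 0.
Proof.
move=> Uz; have := dot_cst_derive a sN sN Uz patch_unit.
rewrite [dot (N z) _]dotC => /eqP; rewrite -addr_eq0 -mulr2n mulrn_eq0/=.
by move/eqP.
Qed.

Lemma patch_dN_tangent a b z : U z ->
  dot (pd a N z) (pd b F z) = - dot (N z) (pd a (pd b F) z).
Proof.
move=> Uz; apply: (dot_cst_derive a sN (smooth_partial b sF) Uz) => y.
exact: patch_normal.
Qed.

Let Fuv z : U z -> pd 0 Fv z = pd 1 Fu z.
Proof. exact: partialC_vec. Qed.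

Let lapN z : U z -> dot (N z) (pd 0 Fu z) + dot (N z) (pd 1 Fv z)
  = - 2 * tilt F N z * dot (Fu z) (Fu z).
Proof.
move=> Uz; case: patch => _ _ /(_ z Uz)[_ _ _].
rewrite dotDr /tilt => /(canRL (mulfK (patch_neq0 Uz))) ->.
by ring.
Qed.

(** The operator dN is symmetric because mixed derivatives of F commute, and
    minimality gives its trace. *)
Lemma weingarten z : U z ->
  Nu z = (2 * tilt F N z) *: Fu z + cross (N z) (Nv z) /\
  Nv z = (2 * tilt F N z) *: Fv z - cross (N z) (Nu z).
Proof.
move=> Uz; apply: (frame_trace (frame Uz) (FvE Uz));
  rewrite ?patch_dN_normal ?patch_dN_tangent// ?Fuv//.
by rewrite -opprD lapN//; ring.
Qed.

(** Differentiating <F, N> = 0 shows that dN is orthogonal to F, and for h = 0 the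
    Weingarten equations carry this over to the direction N x F. Geometrically,
    the surface lies in a plane through the origin. *)
Lemma tilt0_dN : (forall z, U z -> tilt F N z = 0) ->
  forall a z, U z -> pd a N z = 0.
Proof.
move=> t0; have FN y : U y -> dot (F y) (N y) = 0.
  move=> Uy; apply/eqP; have := t0 y Uy; rewrite /tilt => /eqP.
  by rewrite mulf_eq0 invr_eq0 (negPf (patch_neq0 Uy)) orbF.
move=> a z Uz.
have FdN b : dot (F z) (pd b N z) = 0.
  rewrite dotC (dot_cst_derive b sN sF Uz (c := 0)).
    by rewrite patch_normal// oppr0.
  by move=> y Uy; rewrite dotC FN.
have NF : orthogonal_frame (N z) (F z).
  split; [exact: patch_unit|by rewrite dotC FN|].
  by rewrite dotxx_gt0 -dotxx_eq0 patch_neq0.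
have [] := weingarten Uz; rewrite t0// mulr0 !scale0r add0r sub0r => Nu_ Nv_.
apply: (frame_eq NF); rewrite dot0l ?patch_dN_normal// 1?dotC ?FdN//.
have c0 w : dot (F z) w = 0 -> dot (cross (N z) (F z)) (cross (N z) w) = 0.
  by move=> Fw; rewrite dot_cross_cross Fw mulr0 dotC FN// dotC mulr0 subr0.
move: a; apply: ord2P; first by rewrite Nu_ c0.
by rewrite Nv_ dotNr c0// oppr0.
Qed.

(** Differentiating |F_u|^2 = |F_v|^2 and <F_u, F_v> = 0 shows that the Laplacian
    of F is normal. *)
Lemma patch_laplacian z : U z ->
  pd 0 Fu z + pd 1 Fv z = (- 2 * tilt F N z * dot (Fu z) (Fu z)) *: N z.
Proof.
move=> Uz; have nF := patch_normal _ Uz.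
have sFa b := smooth_partial b sF.
have norms a : dot (pd a Fv z) (Fv z) = dot (pd a Fu z) (Fu z).
  have e y : U y -> dot (Fv y) (Fv y) = dot (Fu y) (Fu y).
    by move=> /patch_conformal[].
  have := partial_ext a Uo e Uz.
  rewrite (partial_dot a Uo (sFa 1) (sFa 1) Uz) (partial_dot a Uo (sFa 0) (sFa 0) Uz).
  rewrite [dot (Fv z) (pd a Fv z)]dotC [dot (Fu z) (pd a Fu z)]dotC -!mulr2n.
  by move=> /eqP; rewrite eqrMn2r/= => /eqP.
have orth a : dot (pd a Fu z) (Fv z) = - dot (Fu z) (pd a Fv z).
  apply: (dot_cst_derive a (sFa 0) (sFa 1) Uz (c := 0)) => y.
  by move=> /patch_conformal[].
apply: (patch_eq Uz); last first.
  by rewrite dotDl dotZl patch_unit// mulr1 -lapN// ![dot _ (N z)]dotC.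
apply: ord2P; rewrite dotDl dotZl nF mulr0.
  by rewrite -norms Fuv// orth [dot (Fu z) _]dotC addNr.
by rewrite orth Fuv// [dot (Fu z) _]dotC -norms addNr.
Qed.

Let a2 := fun z => dot (F z) (F z).

(** The field is twice the gradient of log |F|. *)
Lemma log_norm_harmonic : harmonic_field U
  (fun z => pd 0 (fun z => dot (F z) (F z)) z / dot (F z) (F z))
  (fun z => pd 1 (fun z => dot (F z) (F z)) z / dot (F z) (F z)).
Proof.
have sa : smooth_on U a2 by exact: smooth_dot.
have sp b : smooth_on U (pd b a2) by exact: smooth_partial.
have sV : smooth_on U (fun z => (a2 z)^-1).
  by apply: smoothV => // z; exact: patch_neq0.
have D c b z : U z -> pd c (fun z => pd b a2 z / a2 z) z =
    pd c (pd b a2) z / a2 z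
    - pd b a2 z * pd c a2 z / a2 z ^+ 2.
  move=> Uz; rewrite (partialM c (sp b) sV Uz) (partialV c sa Uz (patch_neq0 Uz)).
  by rewrite mulrN mulrA.
have a_1 b y : U y -> pd b a2 y = 2 * dot (F y) (pd b F y).
  by move=> Uy; rewrite (partial_dot b Uo sF sF Uy) dotC; ring.
split; [exact: smoothM|exact: smoothM|..] => z Uz; rewrite !D//; last first.
  by rewrite (partialC 0 1 Uo sa Uz) [pd 0 a2 z * _]mulrC.
have a_2 b : pd b (pd b a2) z = 2 * (dot (pd b F z) (pd b F z) + dot (F z) (pd b (pd b F) z)).
  have s2 : smooth_on U (fun=> 2 : R) by exact: smooth_cst.
  have sFb := smooth_partial b sF.
  rewrite (partial_ext b Uo (a_1 b) Uz) (partialM b s2 (smooth_dot Uo sF sFb) Uz).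
  by rewrite partial_cst mul0r add0r (partial_dot b Uo sF sFb Uz).
rewrite !a_2 !a_1// /a2.
have [c1 _] := patch_conformal Uz; rewrite c1.
have a0 := patch_neq0 Uz.
have := congr1 (dot (F z)) (patch_laplacian Uz).
have := congr1 (dot (F z)) (frame_expand (F z) (frame Uz)).
rewrite -FvE// !dotDr !dotZr /tilt.
move: (dot (Fu z) (Fu z)) (dot (F z) (Fu z)) (dot (F z) (Fv z)) (dot (F z) (N z))
  (dot (F z) (pd 0 (pd 0 F) z)) (dot (F z) (pd 1 (pd 1 F) z)) a0.
move: (dot (F z) (F z)) => a l p q m s s' a0 h1.
move=> /(canRL (addKr _)) ->.
have -> : 2 * q * (2 * q) = 4 * (l * a - p * p - l * m * m).
  by rewrite h1; ring.
by field.
Qed.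

End MinimalPatch.

(** * Two patches with the same normal *)

Section Rigidity.
Context {R : realType}.
Implicit Types (U : set 'rV[R]_2) (F N : 'rV[R]_2 -> 'rV[R]_3).

Lemma minimal_patch_sub U U' F N : U' `<=` U -> minimal_patch U F N ->
  minimal_patch U' F N.
Proof.
move=> U'U [sF sN p]; split; [exact: smooth_sub sF|exact: smooth_sub sN|].
by move=> z /U'U; exact: p.
Qed.

Lemma smooth_tilt U F N : open U -> minimal_patch U F N -> smooth_on U (tilt F N).
Proof.
move=> Uo patch; have [sF sN _] := patch.
apply: smoothM => //; first exact: smooth_dot.
by apply: smoothV => //; [exact: smooth_dot|exact: patch_neq0 patch].
Qed.

Lemma tiltE U F N z : minimal_patch U F N -> U z ->
  dot (F z) (N z) = tilt F N z * dot (F z) (F z).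
Proof. by move=> patch Uz; rewrite /tilt divfK// (patch_neq0 patch). Qed.

Lemma cross_frame_tangent (n e w : 'rV[R]_3) : orthogonal_frame n e ->
  dot w n = 0 ->
  dot e e *: cross n w = dot w e *: cross n e - dot w (cross n e) *: e.
Proof.
move=> ne wn; rewrite (frame_expand _ ne) dot_cross_cross.
have [nn nee _] := ne.
rewrite [dot (cross n w) n]dotC dot_crossl mulr0 scale0r addr0.
rewrite nn nee mul0r subr0 mul1r.
have -> : dot (cross n w) e = - dot w (cross n e).
  by rewrite dotC triple_rot triple_rot crossC dotNr.
by rewrite scaleNr addrC.
Qed.

(** With b = <F, C>, c = |C|^2 and g = 2 b + c, minimality of F and of F + C gives
    <F, N> = h |F|^2 and <C, N> = h g. So V = g F - |F|^2 C is tangent: its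
    integral curves are the circles through 0 and - C, which inversion turns into
    the rulings of a cone. Differentiating the two relations yields
    <V, dN> = 2 h <V, dF>; with the Weingarten equations N has rank one,
    N_a = p_a V. Equality of the mixed derivatives of N, in the direction N x V,
    then says h g = 0. If g vanishes identically, then C is orthogonal to dF and
    to N, so it is zero. *)
Lemma translation_rigidity U F N (C : 'rV[R]_3) : open U -> U !=set0 ->
  minimal_patch U F N -> (forall z, U z -> tilt F N z != 0) ->
  (forall z, U z -> F z + C != 0) ->
  (forall z, U z -> dot (F z + C) (N z) = tilt F N z * dot (F z + C) (F z + C)) ->
  C = 0.
Proof.
move=> Uo [z0 Uz0] patch t0 FC0 FCN; apply/eqP/negPn/negP => C0.
have [sF sN _] := patch.
have sC : smooth_on U (fun=> C) by exact: smooth_cst.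
have st := smooth_tilt Uo patch.
have sa := smooth_dot Uo sF sF.
have sFC := smooth_dot Uo sF sC.
pose g z := 2 * dot (F z) C + dot C C.
have s2 : smooth_on U (fun=> 2 : R) by exact: smooth_cst.
have sc : smooth_on U (fun=> dot C C) by exact: smooth_cst.
have sg : smooth_on U g by apply: smoothD => //; exact: smoothM.
have dg a z : U z -> pd a g z = 2 * dot (pd a F z) C.
  move=> Uz; rewrite (partialD a (smoothM Uo s2 sFC) sc Uz) (partialM a s2 sFC Uz).
  rewrite (partial_dot a Uo sF sC Uz) !partial_cst dot0r.
  by rewrite mul0r add0r !addr0.
have da a z : U z -> pd a (fun z => dot (F z) (F z)) z = 2 * dot (F z) (pd a F z).
  by move=> Uz; rewrite (partial_dot a Uo sF sF Uz) [dot (pd _ _ _) _]dotC; ring.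
have FN z : U z -> dot (F z) (N z) = tilt F N z * dot (F z) (F z).
  exact: tiltE.
have CN z : U z -> dot C (N z) = tilt F N z * g z.
  move=> Uz; have := FCN z Uz.
  rewrite dotDl FN// dotDr !dotDl [dot C (F z)]dotC /g.
  move: (tilt F N z) (dot (F z) (F z)) (dot (F z) C) (dot C C) => t a b c.
  by move=> /(canRL (addKr _)) ->; ring.
pose V z := g z *: F z - dot (F z) (F z) *: C.
have sV1 := smooth_scale Uo sg sF.
have sV2 := smooth_scale Uo sa sC.
have sm1 : smooth_on U (fun=> -1 : R) by exact: smooth_cst.
have sV : smooth_on U V.
  have := smoothD Uo sV1 (smooth_scale Uo sm1 sV2).
  by apply: smooth_ext => // y _; rewrite scaleN1r.
have VN z : U z -> dot (V z) (N z) = 0.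
  by move=> Uz; rewrite dotBl !dotZl FN// CN//; ring.
have VV z : U z -> 0 < dot (V z) (V z).
  move=> Uz; have -> : dot (V z) (V z) =
      dot (F z) (F z) * dot C C * dot (F z + C) (F z + C).
    rewrite /V !dotBl !dotBr !dotZl !dotZr !dotDl !dotDr [dot C (F z)]dotC /g.
    by ring.
  rewrite mulr_gt0 ?dotxx_gt0 ?FC0//.
  by rewrite mulr_gt0 ?dotxx_gt0// -dotxx_eq0 (patch_neq0 patch).
have VNa a z : U z -> dot (V z) (pd a N z) = 2 * tilt F N z * dot (V z) (pd a F z).
  move=> Uz.
  have e1 : dot (F z) (pd a N z) = pd a (tilt F N) z * dot (F z) (F z)
      + 2 * tilt F N z * dot (F z) (pd a F z).
    have := partial_ext a Uo FN Uz.
    rewrite (partial_dot a Uo sF sN Uz) (partialM a st sa Uz) da//.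
    by rewrite [dot (pd _ _ _) _]dotC (patch_normal patch)// add0r => ->; ring.
  have e2 : dot C (pd a N z) = pd a (tilt F N) z * g z
      + 2 * tilt F N z * dot (pd a F z) C.
    have := partial_ext a Uo CN Uz.
    rewrite (partial_dot a Uo sC sN Uz) (partialM a st sg Uz) dg//.
    by rewrite partial_cst dot0l add0r => ->; ring.
  rewrite /V !dotBl !dotZl e1 e2 [dot C (pd a F z)]dotC; ring.
have NV z : U z -> orthogonal_frame (N z) (V z).
  move=> Uz; split; [exact: (patch_unit patch)|by rewrite dotC VN|exact: VV].
have triple a z : dot (pd a N z) (cross (N z) (V z)) =
    - dot (V z) (cross (N z) (pd a N z)).
  by rewrite triple_rot triple_rot crossC dotNr.
(* In the Weingarten equations paired with V, the terms 2 h <V, dF> cancel by VNa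
   and leave <V, N x N_a> = 0. *)
have NaW a z : U z -> dot (pd a N z) (cross (N z) (V z)) = 0.
  move=> Uz; have [w0 w1] := weingarten Uo patch Uz.
  move: a; apply: ord2P; rewrite triple; apply/eqP; rewrite oppr_eq0; apply/eqP.
    have := VNa 1 z Uz; rewrite [in X in X = _ -> _]w1 dotBr dotZr.
    by rewrite -[X in _ = X -> _]subr0 => /addrI /oppr_inj.
  have := VNa 0 z Uz; rewrite [in X in X = _ -> _]w0 dotDr dotZr.
  by rewrite -[X in _ = X -> _]addr0 => /addrI.
pose p a z := 2 * tilt F N z * dot (V z) (pd a F z) / dot (V z) (V z).
have NpV a z : U z -> pd a N z = p a z *: V z.
  move=> Uz; apply: (frame_eq (NV z Uz)); rewrite dotZl.
  - by rewrite dotC VNa// /p divfK// gt_eqF// VV.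
  - by rewrite NaW// dot_crossr mulr0.
  - by rewrite (patch_dN_normal Uo patch)// VN// mulr0.
have sp a : smooth_on U (p a).
  apply: smoothM => //; first apply: smoothM => //.
  - exact: smoothM.
  - by apply: smooth_dot => //; exact: smooth_partial.
  - apply: smoothV => // [|z Uz]; first exact: smooth_dot.
    by rewrite gt_eqF// VV.
have dV a z : U z -> pd a V z = (2 * dot (pd a F z) C) *: F z + g z *: pd a F z
    - (2 * dot (F z) (pd a F z)) *: C.
  move=> Uz.
  have Ve y : U y -> V y = g y *: F y + (-1) *: (dot (F y) (F y) *: C).
    by move=> _; rewrite scaleN1r.
  rewrite (partial_ext a Uo Ve Uz) (partialD a sV1 (smooth_scale Uo sm1 sV2) Uz).
  rewrite (partial_scale a Uo sg sF Uz) (partial_scale a Uo sm1 sV2 Uz).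
  rewrite (partial_scale a Uo sa sC Uz) dg// da// !partial_cst.
  by rewrite scale0r scaler0 add0r addr0 scaleN1r.
have g0 z : U z -> g z = 0.
  clearbody V => Uz.
  have W1 : p 0 z * dot (pd 1 V z) (cross (N z) (V z)) =
            p 1 z * dot (pd 0 V z) (cross (N z) (V z)).
    have := partialC_vec 0 1 Uo sN Uz.
    rewrite (partial_ext 1 Uo (NpV 0) Uz) (partial_ext 0 Uo (NpV 1) Uz).
    rewrite (partial_scale _ Uo (sp _) sV Uz) (partial_scale _ Uo (sp _) sV Uz).
    move=> /(congr1 (dot (cross (N z) (V z)))); rewrite !dotDr !dotZr.
    rewrite [dot _ (V z)]dotC dot_crossr !mulr0 !add0r.
    by rewrite ![dot (cross _ _) _]dotC => ->.
  have W2 : dot (V z) (pd 0 F z) * dot (pd 1 V z) (cross (N z) (V z)) =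
            dot (V z) (pd 1 F z) * dot (pd 0 V z) (cross (N z) (V z)).
    move: W1; rewrite /p.
    have k0 : 2 * tilt F N z / dot (V z) (V z) != 0.
      have v0 := VV z Uz.
      by rewrite mulf_neq0 ?invr_neq0 ?(lt0r_neq0 v0)// mulf_neq0 ?t0// pnatr_eq0.
    rewrite ![2 * _ * dot _ _ / _]mulrAC -[X in X = _ -> _]mulrA.
    by rewrite -[X in _ = X -> _]mulrA => /(mulfI k0).
  have [_ _ fr] := patch; have [_ nef FvE _] := fr z Uz.
  (* By W2 the derivative of V in the direction <V, F_u> F_v - <V, F_v> F_u, which
     is |F_u|^2 N x V, has no component along N x V; computed from dV, this
     component is g |F_u|^2 |V|^2. *)
  have VY := cross_frame_tangent nef (VN z Uz); rewrite -FvE in VY.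
  have dY w := congr1 (dot w) VY; move: (dY C) (dY (F z)) (dY (cross (N z) (V z))).
  rewrite !dotBr !dotZr dot_cross_cross (patch_unit patch)// [dot (N z) (V z)]dotC.
  rewrite VN// mul0r subr0 mul1r.
  move: W2; rewrite !dV// !dotBl !dotDl !dotZl.
  rewrite ![dot (cross _ _) (pd _ _ _)]dotC ![dot C (pd _ _ _)]dotC.
  have [_ _ e0] := nef; have v0 := VV z Uz; move: e0 v0.
  move: (dot (pd 0 F z) (pd 0 F z)) (dot (V z) (V z)) => l v l0 v0.
  move: (dot (V z) (pd 0 F z)) (dot (V z) (pd 1 F z)) => x0 x1.
  move: (dot (pd 0 F z) C) (dot (pd 1 F z) C) => c0 c1.
  move: (dot (F z) (pd 0 F z)) (dot (F z) (pd 1 F z)) => f0 f1.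
  move: (dot (pd 0 F z) _) (dot (pd 1 F z) _) => w0 w1.
  move: (dot (F z) (cross _ _)) (dot C _) (g z) => fw cw q E hC hF hW.
  have : q * (l * v) = 0.
    rewrite hW.
    have -> : q * (x0 * w1 - x1 * w0) =
      x0 * (2 * c1 * fw + q * w1 - 2 * f1 * cw)
      - x1 * (2 * c0 * fw + q * w0 - 2 * f0 * cw)
      - 2 * (x0 * c1 - x1 * c0) * fw + 2 * (x0 * f1 - x1 * f0) * cw by ring.
    by rewrite E -hC -hF; ring.
  by move/eqP; rewrite !mulf_eq0 (gt_eqF l0) (gt_eqF v0) !orbF => /eqP.
have C_0 : C = 0.
  apply: (patch_eq patch Uz0) => [a|]; rewrite dot0l; last first.
    by rewrite CN// g0// mulr0.
  have := dg a z0 Uz0; rewrite (partial_ext a Uo g0 Uz0) partial_cst.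
  by rewrite dotC => /esym/eqP; rewrite mulf_eq0 pnatr_eq0/= => /eqP.
by rewrite C_0 eqxx in C0.
Qed.

End Rigidity.

Section TwoPatches.
Context {R : realType}.
Variables (U : set 'rV[R]_2) (F Fh N : 'rV[R]_2 -> 'rV[R]_3).
Hypothesis Uo : open U.
Hypothesis patch : minimal_patch U F N.
Hypothesis patchh : minimal_patch U Fh N.

Let sF : smooth_on U F. Proof. by case: patch. Qed.
Let sFh : smooth_on U Fh. Proof. by case: patchh. Qed.

(** Both sides are given by the Weingarten equations in terms of N. *)
Lemma tilt_pd a z : U z -> tilt Fh N z *: pd a Fh z = tilt F N z *: pd a F z.
Proof.
move=> Uz; have [w0 w1] := weingarten Uo patch Uz.
have [h0 h1] := weingarten Uo patchh Uz.
have half (s t : R) (v w : 'rV[R]_3) : (2 * s) *: v = (2 * t) *: w -> s *: v = t *: w.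
  rewrite -!scalerA => /(congr1 (fun x => 2^-1 *: x)).
  by rewrite !scalerA !mulrA mulVf ?mul1r// pnatr_eq0.
by move: a; apply: ord2P; apply: half;
  [move: h0; rewrite w0 => /addIr|move: h1; rewrite w1 => /addIr] => ->.
Qed.

Lemma tilt_eq0 z : U z -> (tilt Fh N z == 0) = (tilt F N z == 0).
Proof.
move=> Uz.
have pd_neq0 G : minimal_patch U G N -> pd 0 G z != 0.
  by move=> [_ _ /(_ z Uz)[_ [_ _ e0] _ _]]; rewrite -dotxx_gt0.
have := congr1 (fun v => v == 0) (tilt_pd 0 Uz); rewrite !scaler_eq0.
by rewrite (negPf (pd_neq0 _ patch)) (negPf (pd_neq0 _ patchh)) !orbF.
Qed.

(** The ratio r of the two differentials is the quotient of the tilts. Commuting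
    derivatives give r_v F_u = r_u F_v, so r is locally constant, and
    translation_rigidity removes the constant of integration. *)
Lemma local_homothety z : U z -> tilt F N z != 0 ->
  exists2 r, r != 0 & \forall y \near z, Fh y = r *: F y.
Proof.
move=> Uz t0; have th0 : tilt Fh N z != 0 by rewrite tilt_eq0.
have st := smooth_tilt Uo patch; have sth := smooth_tilt Uo patchh.
have : \forall y \near z, U y /\ tilt F N y != 0.
  have UN : \forall y \near z, U y by exact: open_nbhs_nbhs.
  have nt : 0 < `|tilt F N z| by rewrite normr_gt0.
  apply: filterS2 UN (smooth_near_dist st Uz nt) => y Uy dy; split => //.
  by apply: contraTneq dy => ->; rewrite subr0 ltxx.
move=> /nbhs_ballP[e /= e0 zU].
pose U' := ball z e; have U'o : open U' by exact: ball_open.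
have U'U : U' `<=` U by move=> y /zU[].
have U't y : U' y -> tilt F N y != 0 by move=> /zU[].
have U'th y : U' y -> tilt Fh N y != 0.
  by move=> U'y; rewrite tilt_eq0; [exact: U't|exact: U'U].
pose r y := tilt F N y * (tilt Fh N y)^-1.
have sF' := smooth_sub U'U sF.
have sFh' := smooth_sub U'U sFh.
have sr : smooth_on U' r.
  apply: smoothM => //; first exact: smooth_sub st.
  by apply: smoothV => //; exact: smooth_sub sth.
have dFh a y : U' y -> pd a Fh y = r y *: pd a F y.
  move=> U'y; rewrite /r mulrC -scalerA -tilt_pd ?scalerA; last exact: U'U.
  by rewrite mulVf ?scale1r// U'th.
have dr a y : U' y -> pd a r y = 0.
  move=> U'y; have Uy := U'U y U'y.
  have : pd 1 r y *: pd 0 F y = pd 0 r y *: pd 1 F y.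
    have := partialC_vec 1 0 U'o sFh' U'y.
    rewrite (partial_ext 1 U'o (dFh 0) U'y) (partial_ext 0 U'o (dFh 1) U'y).
    rewrite (partial_scale 1 U'o sr (smooth_partial 0 sF') U'y).
    rewrite (partial_scale 0 U'o sr (smooth_partial 1 sF') U'y).
    by rewrite (partialC_vec 1 0 U'o sF' U'y) => /addIr.
  have [c1 c2] := patch_conformal patch Uy.
  have l0 : dot (pd 0 F y) (pd 0 F y) != 0.
    by case: patch => _ _ /(_ y Uy)[_ [_ _ l0] _ _]; rewrite gt_eqF.
  move=> E; have E0 := congr1 (dot (pd 0 F y)) E.
  have E1 := congr1 (dot (pd 1 F y)) E.
  move: E0 E1; rewrite !dotZr c1 c2 [dot (pd 1 F y) _]dotC c2 !mulr0 => E0 E1.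
  move: a; apply: ord2P; apply/eqP.
    by move/esym/eqP: E1; rewrite mulf_eq0 (negPf l0) orbF.
  by move/eqP: E0; rewrite mulf_eq0 (negPf l0) orbF.
have zU' : U' z by exact: ballxx.
have rz0 : r z != 0 by rewrite mulf_neq0 ?invr_neq0.
have rE y : U' y -> r y = r z.
  by apply: (constant_on_ball sr) => [//|a x]; exact: dr.
pose C := Fh z - r z *: F z.
have FhE y : U' y -> Fh y = r z *: F y + C.
  move=> U'y; suff : Fh y - r z *: F y = C by move=> <-; rewrite addrC subrK.
  apply/rowP => k; rewrite !mxE.
  have sk := smooth_vec_coord k U'o sF'; have shk := smooth_vec_coord k U'o sFh'.
  have srz : smooth_on U' (fun=> r z) by exact: smooth_cst.
  have srk := smoothM U'o srz sk.
  apply: (constant_on_ball (smoothB U'o shk srk) _ _ U'y) => // a x U'x.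
  rewrite (partialB a shk srk U'x) (partialM a srz sk U'x) partial_cst.
  rewrite -(partial_vec _ _ sFh' U'x) -(partial_vec _ _ sF' U'x) dFh// rE//.
  by rewrite mxE mul0r add0r subrr.
clearbody C.
have FCE y : U' y -> F y + (r z)^-1 *: C = (r z)^-1 *: Fh y.
  by move=> U'y; rewrite FhE// scalerDr scalerA mulVf// scale1r.
suff C0 : (r z)^-1 *: C = 0.
  exists (r z) => //; apply/nbhs_ballP; exists e => // y U'y; rewrite FhE//.
  by move/eqP: C0; rewrite scaler_eq0 invr_eq0 (negPf rz0)/= => /eqP ->; rewrite addr0.
apply: (translation_rigidity U'o _ (minimal_patch_sub U'U patch) U't).
- by exists z.
- move=> y U'y; rewrite FCE// scaler_eq0 negb_or invr_eq0 rz0/=.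
  by rewrite -dotxx_eq0 (patch_neq0 patchh)//; exact: U'U.
- move=> y U'y; rewrite FCE// !dotZl dotZr (tiltE patchh) ; last exact: U'U.
  have -> : tilt F N y = r z * tilt Fh N y by rewrite -(rE y)// divfK// U'th.
  move: rz0; move: (r z) (tilt Fh N y) (dot (Fh y) (Fh y)) => x t b x0.
  by field.
Qed.

Definition norm_ratio z : R := dot (Fh z) (Fh z) / dot (F z) (F z).

Let sn := smooth_dot Uo sF sF.
Let snh := smooth_dot Uo sFh sFh.

Lemma smooth_norm_ratio : smooth_on U norm_ratio.
Proof. by apply: smoothM => //; apply: smoothV => // z; exact: (patch_neq0 patch). Qed.

Lemma pd_norm_ratio a z : U z -> pd a norm_ratio z = norm_ratio z *
  (pd a (fun z => dot (Fh z) (Fh z)) z / dot (Fh z) (Fh z)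
   - pd a (fun z => dot (F z) (F z)) z / dot (F z) (F z)).
Proof.
move=> Uz; have n0 := patch_neq0 patch Uz; have nh0 := patch_neq0 patchh Uz.
have sV : smooth_on U (fun z => (dot (F z) (F z))^-1).
  by apply: smoothV => // y; exact: (patch_neq0 patch).
rewrite (partialM a snh sV Uz) (partialV a sn Uz n0) /norm_ratio.
move: (pd _ _ _) (pd _ _ _) (dot _ _) (dot _ _) n0 nh0 => p q b c b0 c0.
by field; rewrite b0 c0.
Qed.

Lemma norm_ratio_neq0 z : U z -> norm_ratio z != 0.
Proof.
move=> Uz; rewrite mulf_neq0 ?invr_neq0//.
  exact: (patch_neq0 patchh).
exact: (patch_neq0 patch).
Qed.

(** The radius d does not depend on the point c near which the ratio is known to be
    constant: a disc around c that contains z is needed. *)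
Lemma norm_ratio_continuation z : U z -> exists2 d : R, 0 < d &
  forall c, ball z d c -> (\forall y \near c, norm_ratio y = norm_ratio c) ->
  \forall y \near z, norm_ratio y = norm_ratio z.
Proof.
move=> Uz; have [e e0 zU] := open_ball_sub Uo Uz.
exists (e / 6); first by rewrite divr_gt0.
move=> c zc /nbhs_ballP[d /= d0 cq].
(* A sup-norm distance below e / 6 is a Euclidean distance below e / 3, and the
   closed disc of radius e / 3 around c stays in the ball of radius e around z. *)
pose r := e / 3; have r0 : 0 < r by rewrite divr_gt0.
have rU x : sqdist c x <= r ^+ 2 -> ball z e x.
  move=> xr; have : ball c (e / 2) x.
    apply: sqdist_ball; first by rewrite divr_gt0.
    by rewrite (le_lt_trans xr)// ltr_pXn2r// ?nnegrE /r; lra.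
  have -> : e = e / 6 + (e - e / 6) by lra.
  move=> cx; apply: (ball_triangle zc); apply: le_ball cx; lra.
pose A a := fun z => pd a (fun z => dot (Fh z) (Fh z)) z / dot (Fh z) (Fh z)
   - pd a (fun z => dot (F z) (F z)) z / dot (F z) (F z).
have hA : harmonic_field U (A 0) (A 1).
  apply: (harmonic_fieldB Uo (log_norm_harmonic Uo patchh) (log_norm_harmonic Uo patch)).
have A0 a x : ball z e x -> pd a norm_ratio x = 0 -> A a x = 0.
  move=> zx; have Ux := zU _ zx; rewrite pd_norm_ratio// => /eqP.
  by rewrite mulf_eq0 (negPf (norm_ratio_neq0 Ux))/= => /eqP.
pose V := ball z e `&` [set x | sqdist c x < r ^+ 2].
have Vo : open V.
  apply: openI; first exact: ball_open.
  rewrite (_ : mkset _ = sqdist c @^-1` `]-oo, (r ^+ 2)[%classic).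
    apply: open_comp; last exact: interval_open.
    by move=> y _; exact: sqdist_continuous.
  by apply/seteqP; split=> y; rewrite /= in_itv.
have zcr : sqdist c z < r ^+ 2.
  have /ball_sqdist := ball_sym zc; rewrite /r => h; apply: lt_trans h _.
  by rewrite -subr_gt0 (_ : _ - _ = e ^+ 2 / 18) ?divr_gt0 ?exprn_gt0//; field.
pose m := Num.min d r; have m0 : 0 < m by rewrite lt_min d0.
have near_c x : sqdist c x < m ^+ 2 -> A 0 x = 0 /\ A 1 x = 0.
  move=> xm.
  have sq_le s : m <= s -> sqdist c x < s ^+ 2.
    by move=> ms; apply: lt_le_trans xm _; rewrite lerXn2r// nnegrE ltW// (lt_le_trans m0).
  have cx : ball c d x by apply: sqdist_ball => //; apply: sq_le; rewrite ge_min lexx.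
  have zx : ball z e x by apply/rU/ltW/sq_le; rewrite ge_min lexx orbT.
  have p0 a : pd a norm_ratio x = 0.
    by rewrite (partial_ext a (ball_open c d) cq cx) partial_cst.
  by split; apply: A0.
have pd0 a x : V x -> pd a norm_ratio x = 0.
  move=> [zx xr]; rewrite pd_norm_ratio; last exact: zU.
  rewrite -/(A a x).
  have hA' : harmonic_field (ball z e) (A 0) (A 1).
    by case: hA => sA0 sA1 d1 d2; split=> [||y /zU|y /zU];
      [exact: smooth_sub sA0|exact: smooth_sub sA1|exact: d1|exact: d2].
  have [] := harmonic_field_continuation (ball_open z e) hA' r0 rU m0 near_c xr.
  by move=> A0x A1x; move: a; apply: ord2P; rewrite ?A0x ?A1x mulr0.
have [d' d'0 zV] := open_ball_sub Vo (conj (ballxx z e0) zcr).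
apply/nbhs_ballP; exists d' => // y.
apply: (constant_on_ball _ zV) => //.
by apply: smooth_sub smooth_norm_ratio => x [/zU].
Qed.

Definition dot_ratio z : R := dot (Fh z) (F z) / dot (F z) (F z).

Lemma smooth_dot_ratio : smooth_on U dot_ratio.
Proof.
apply: smoothM => //; first exact: smooth_dot.
by apply: smoothV => // z; exact: (patch_neq0 patch).
Qed.

End TwoPatches.

Section RadialTangent.
Context {R : realType} (U : set 'rV[R]_2) (F N : 'rV[R]_2 -> 'rV[R]_3).
Hypothesis patch : minimal_patch U F N.

(** Where h = 0, the vectors F, F_u and F_v lie in the plane orthogonal to N. With
    the complex structure w |-> N x w on this plane, F_v = i F_u, so the complex
    number F_u / F has real part d_u log |F| and imaginary part - d_v log |F|. *)
Lemma tilt0_pd z : U z -> tilt F N z = 0 ->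
  dot (F z) (F z) *: pd 0 F z = dot (F z) (pd 0 F z) *: F z
    + (- dot (F z) (pd 1 F z)) *: cross (N z) (F z) /\
  dot (F z) (F z) *: pd 1 F z = dot (F z) (pd 1 F z) *: F z
    + dot (F z) (pd 0 F z) *: cross (N z) (F z).
Proof.
move=> Uz t0; have FN : dot (F z) (N z) = 0 by rewrite (tiltE patch)// t0 mul0r.
have NF : orthogonal_frame (N z) (F z).
  split; [exact: (patch_unit patch)|by rewrite dotC|].
  by rewrite dotxx_gt0 -dotxx_eq0 (patch_neq0 patch).
have [_ _ /(_ z Uz)[_ nef FvE _]] := patch; have [nn ne _] := nef.
have nF := patch_normal patch _ Uz.
split; rewrite (frame_expand _ NF) ![dot (pd _ _ _) (N z)]dotC nF mulr0 scale0r addr0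
  [dot (pd _ _ _) (F z)]dotC; congr (_ + _ *: _).
  by rewrite FvE triple_rot triple_rot crossC dotNr.
by rewrite FvE dot_cross_cross nn [dot (N z) (F z)]dotC FN mul0r subr0 mul1r dotC.
Qed.

End RadialTangent.

Section DotRatio.
Context {R : realType}.
Variables (U : set 'rV[R]_2) (F Fh N : 'rV[R]_2 -> 'rV[R]_3).
Hypothesis Uo : open U.
Hypothesis patch : minimal_patch U F N.
Hypothesis patchh : minimal_patch U Fh N.

(** Where h is nonzero, Fh = r F near z; where h = 0, tilt0_pd shows that F and Fh
    have the same logarithmic derivative in the plane orthogonal to N. *)
Lemma pd_dot_ratio a z : U z ->
  (forall b, pd b (norm_ratio F Fh) z = 0) -> pd a (dot_ratio F Fh) z = 0.
Proof.
move=> Uz q0.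
have [sF _ _] := patch; have [sFh _ _] := patchh.
have b0 := patch_neq0 patch Uz; have c0 := patch_neq0 patchh Uz.
have [t0|t0] := eqVneq (tilt F N z) 0; last first.
  have [r r0 /nbhs_ballP[e /= e0 zr]] := local_homothety Uo patch patchh Uz t0.
  have [d d0 zU] := open_ball_sub Uo Uz.
  pose m := Num.min e d.
  have K y : ball z m y -> dot_ratio F Fh y = r.
    move=> zy; rewrite /dot_ratio zr ?dotZl ?mulfK//.
      by apply: (patch_neq0 patch); apply: zU; apply: le_ball zy; rewrite ge_min lexx orbT.
    by apply: le_ball zy; rewrite ge_min lexx.
  have m0 : 0 < m by rewrite lt_min e0.
  by rewrite (partial_ext a (ball_open z m) K (ballxx z m0)) partial_cst.
have th0 : tilt Fh N z = 0 by apply/eqP; rewrite (tilt_eq0 Uo patch patchh)// t0.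
have s b : dot (Fh z) (pd b Fh z) / dot (Fh z) (Fh z) = dot (F z) (pd b F z) / dot (F z) (F z).
  have := q0 b; rewrite (pd_norm_ratio Uo patch patchh)// => /eqP.
  rewrite mulf_eq0 (negPf (norm_ratio_neq0 patch patchh Uz))/= subr_eq0.
  rewrite (partial_dot b Uo sFh sFh Uz) (partial_dot b Uo sF sF Uz).
  rewrite ![dot (pd _ _ _) _]dotC -!mulr2n !mulrnAl.
  by rewrite eqrMn2r/= => /eqP.
have sn := smooth_dot Uo sF sF.
have sV : smooth_on U (fun z => (dot (F z) (F z))^-1).
  by apply: smoothV => // y; exact: (patch_neq0 patch).
rewrite (partialM a (smooth_dot Uo sFh sF) sV Uz) (partialV a sn Uz b0).
rewrite (partial_dot a Uo sFh sF Uz) (partial_dot a Uo sF sF Uz).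
have [u1 v1] := tilt0_pd patch Uz t0.
have [u2 v2] := tilt0_pd patchh Uz th0.
have [s0 s1] := (s 0, s 1); move: s0 s1 => /(canRL (divfK c0)) s0 /(canRL (divfK c0)) s1.
have J : dot (Fh z) (cross (N z) (F z)) = - dot (F z) (cross (N z) (Fh z)).
  by rewrite triple_rot triple_rot crossC dotNr.
have e1 := congr1 (dot (Fh z)) u1; have e2 := congr1 (dot (F z)) u2.
have e3 := congr1 (dot (Fh z)) v1; have e4 := congr1 (dot (F z)) v2.
move: e1 e2 e3 e4; rewrite !dotDr !dotZr J [dot (F z) (Fh z)]dotC s0 s1.
rewrite [dot (pd a F z) _]dotC [dot (pd a Fh z) _]dotC.
move=> e1 e2 e3 e4; suff : dot (F z) (pd a Fh z) + dot (Fh z) (pd a F z) =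
    2 * dot (F z) (pd a F z) * dot (Fh z) (F z) / dot (F z) (F z).
  by move=> ->; field.
have div (x y c : R) : c != 0 -> c * x = y -> x = y / c.
  by move=> c00 <-; rewrite mulrC mulKf.
move: a; apply: ord2P.
  by rewrite (div _ _ _ b0 e1) (div _ _ _ c0 e2); field; rewrite b0 c0.
by rewrite (div _ _ _ b0 e3) (div _ _ _ c0 e4); field; rewrite b0 c0.
Qed.

End DotRatio.

(** * Minimality in terms of the Euclidean geometry *)

Section MeanCurvature.
Context {R : realType}.
Implicit Types (x v w p : 'rV[R]_3) (F : 'rV[R]_2 -> 'rV[R]_3).

Lemma enorm_expN2 x : enorm x ^- 2 = (dot x x)^-1.
Proof. by rewrite /enorm sqr_sqrtr// dotxx_ge0. Qed.

Lemma dmu2E x : dmu2 x = ((dot x x)^-1)%:M.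
Proof. by rewrite /dmu2 enorm_expN2. Qed.

Lemma enorm_gt0 x : (0 < enorm x) = (x != 0).
Proof. by rewrite sqrtr_gt0 dotxx_gt0. Qed.

Lemma dot_mulmx v w : (v *m w^T) 0 0 = dot v w.
Proof. by rewrite mxE; apply: eq_bigr => k _; rewrite mxE. Qed.

Lemma smooth_id : smooth_on setT (@id 'rV[R]_3).
Proof. by apply: smooth_vec => [|k]; [exact: openT|exact: smooth_coord]. Qed.

Lemma pd_dotxx i x : pd i (fun y : 'rV[R]_3 => dot y y) x = 2 * x 0 i.
Proof.
rewrite (partial_dot i openT smooth_id smooth_id)//.
have -> : pd i id x = delta_mx 0 i.
  apply/rowP => k; rewrite (partial_vec i k smooth_id)// partial_coord mxE eqxx.
  by rewrite eq_sym.
have dx : dot (delta_mx 0 i) x = x 0 i.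
  rewrite /dot (bigD1 i)//= big1 ?addr0 => [|k ki].
    by rewrite mxE !eqxx mul1r.
  by rewrite mxE (negPf ki) andbF mul0r.
by rewrite [dot x _]dotC dx; ring.
Qed.

Lemma partial_dmu2 i j l x : x != 0 -> partial i (fun y => dmu2 y j l) x =
  - (2 * x 0 i / dot x x ^+ 2) * (j == l)%:R.
Proof.
move=> x0.
have e : (fun y : 'rV[R]_3 => dmu2 y j l : R) =
    (fun y => (dot y y)^-1 * (j == l)%:R).
  by apply/funext => y; rewrite dmu2E mxE mulr_natr.
rewrite [in LHS]e.
have xx : [set y | y != 0] x by [].
have no : open [set y : 'rV[R]_3 | y != 0].
  have -> : [set y | y != 0] = (fun y : 'rV[R]_3 => dot y y) @^-1` `]0, +oo[%classic.
    by apply/seteqP; split=> y; rewrite /= in_itv/= andbT dotxx_gt0.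
  apply: open_comp; last exact: interval_open.
  move=> y _; apply: (smooth_continuous (smooth_dot openT smooth_id smooth_id)).
  by [].
have sd : smooth_on [set y : 'rV[R]_3 | y != 0] (fun y => dot y y).
  by apply: smooth_sub (smooth_dot openT smooth_id smooth_id).
have sV : smooth_on [set y : 'rV[R]_3 | y != 0] (fun y => (dot y y)^-1).
  by apply: smoothV => // y y0; rewrite dotxx_eq0.
have sc : smooth_on [set y : 'rV[R]_3 | y != 0] (fun=> (j == l)%:R : R).
  exact: smooth_cst.
rewrite -pdE (partialM i sV sc xx) partial_cst mulr0 addr0.
by rewrite (partialV i sd xx) ?dotxx_eq0// pd_dotxx.
Qed.

Lemma christoffelE x k i j : x != 0 -> christoffel x k i j =
  - (x 0 i * (j == k)%:R + x 0 j * (i == k)%:R - x 0 k * (i == j)%:R) / dot x x.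
Proof.
move=> x0; rewrite /christoffel dmu2E invmx_scalar invrK.
have a0 : dot x x != 0 by rewrite dotxx_eq0.
rewrite (bigD1 k)//= big1 ?addr0 => [|l lk]; last first.
  by rewrite mxE eq_sym (negPf lk) mul0r.
by rewrite !partial_dmu2// mxE eqxx mulr1n; field.
Qed.

Lemma christoffel_sum x p k : x != 0 ->
  \sum_i \sum_j christoffel x k i j * p 0 i * p 0 j =
  - (2 * dot x p * p 0 k - dot p p * x 0 k) / dot x x.
Proof.
move=> x0.
transitivity (\sum_i \sum_j
    - (x 0 i * (j == k)%:R + x 0 j * (i == k)%:R - x 0 k * (i == j)%:R)
    / dot x x * p 0 i * p 0 j).
  by apply: eq_bigr => i _; apply: eq_bigr => j _; rewrite christoffelE.
move: (dot x x)^-1 => b; rewrite !dotE.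
have ne : ((0 == 1 :> 'I_3) = false) * ((1 == 0 :> 'I_3) = false)
  * ((0 == 2 :> 'I_3) = false) * ((2 == 0 :> 'I_3) = false)
  * ((1 == 2 :> 'I_3) = false) * ((2 == 1 :> 'I_3) = false) by [].
by move: k; apply: ord3P; rewrite !sum3E !eqxx !ne /=; ring.
Qed.

(** The Christoffel symbols of |x|^-2 times the Euclidean metric change the normal
    component of the acceleration by |F_a|^2 <F, n> / |F|^2. *)
Lemma cov_deriv_normal F z a n : F z != 0 -> dot n (pd a F z) = 0 ->
  dot (cov_deriv F z a a) n = dot n (pd a (pd a F) z)
    + dot (pd a F z) (pd a F z) * dot (F z) n / dot (F z) (F z).
Proof.
rewrite pdE => F0 pn.
have -> : cov_deriv F z a a = partial a (partial a F) z
   + (- (2 * dot (F z) (partial a F z)) / dot (F z) (F z)) *: partial a F z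
   + (dot (partial a F z) (partial a F z) / dot (F z) (F z)) *: F z.
  apply/rowP => k; rewrite !mxE christoffel_sum//.
  by move: (partial a (partial a F) z) (partial a F z) => u v; ring.
rewrite -!pdE in pn *; rewrite !dotDl !dotZl [dot _ n]dotC [dot (pd a F z) n]dotC.
by rewrite pn; ring.
Qed.

Lemma unit_normalE F z : unit_normal F z = enorm (F z) *: normal_coef F z.
Proof.
rewrite [in RHS](row_sum_delta (normal_coef F z)) scaler_sumr.
by apply: eq_bigr => j _; rewrite /frame !scalerA mulrC.
Qed.

Lemma first_ffE F z a b : differentiable F z ->
  first_ff F z a b = dot (partial a F z) (partial b F z) / dot (F z) (F z).
Proof.
move=> dF; rewrite /first_ff dmu2E mul_mx_scalar -scalemxAl !mxE mulrC.
congr (_ * _); rewrite /dot; apply: eq_bigr => k _.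
have row c : partial c F z = row c ('J F z).
  by rewrite /partial deriveEjacobian// rowE.
by rewrite !row !mxE.
Qed.

Lemma second_ffE F z a b : second_ff F z a b =
  enorm (F z) / dot (F z) (F z) * dot (cov_deriv F z a b) (normal_coef F z).
Proof.
rewrite mxE /dmu2_inner dmu2E mul_mx_scalar -scalemxAl mxE dot_mulmx.
by rewrite unit_normalE dotZr; ring.
Qed.

Lemma minimal_patch_of_chart U F (cf : 'rV[R]_2 -> R) : open U -> smooth_on U F ->
  (forall z, U z -> F z != 0) -> (forall z, U z -> 0 < cf z) ->
  (forall z, U z -> exists rho, 0 < rho /\ first_ff F z = rho *: (cf z)%:M) ->
  (forall z, U z -> mean_curvature F z = 0) ->
  minimal_patch U F (normal_coef F).
Proof.
move=> Uo sF F0 cf0 conf H0.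
have ff z : U z -> exists2 l, 0 < l &
    forall a b, dot (pd a F z) (pd b F z) = l * (a == b)%:R /\
    first_ff F z = (l / dot (F z) (F z))%:M.
  move=> Uz; have [rho [rho0 E]] := conf z Uz.
  have a0 : 0 < dot (F z) (F z) by rewrite dotxx_gt0 F0.
  exists (rho * cf z * dot (F z) (F z)); first by rewrite !mulr_gt0// cf0.
  move=> a b; split; last by rewrite mulfK ?gt_eqF// E scale_scalar_mx.
  have := first_ffE a b (smooth_differentiable sF Uz).
  rewrite E pdE => /(canLR (divfK (lt0r_neq0 a0))) <-.
  by rewrite !mxE mulrnAr -mulr_natr; ring.
have wE z : U z -> exists2 l, 0 < l & [/\ dot (pd 0 F z) (pd 0 F z) = l,
    dot (pd 1 F z) (pd 1 F z) = l, dot (pd 0 F z) (pd 1 F z) = 0,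
    normal_coef F z = l^-1 *: cross (pd 0 F z) (pd 1 F z) &
    first_ff F z = (l / dot (F z) (F z))%:M].
  move=> Uz; have [l l0 fE] := ff z Uz; exists l => //.
  have [h00 ffE] := fE 0 0; have [h01 _] := fE 0 1; have [h11 _] := fE 1 1.
  rewrite !mulr1 in h00 h11; rewrite mulr0 in h01.
  split => //; rewrite /normal_coef -pdE /enorm dot_cross_cross h00 h01 h11.
  by rewrite [dot (pd 1 F z) _]dotC h01 mulr0 subr0 -expr2 sqrtr_sqr gtr0_norm.
split => //.
  apply: (@smooth_ext _ _ _ U (fun z =>
    (dot (pd 0 F z) (pd 0 F z))^-1 *: cross (pd 0 F z) (pd 1 F z))) => //.
    by move=> z Uz; have [l _ [-> _ _ -> _]] := wE z Uz.
  have s a := smooth_partial a sF.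
  apply: smooth_scale => //; last exact: smooth_cross.
  apply: smoothV => //; first exact: smooth_dot.
  by move=> z Uz; have [l l0 [-> _ _ _]] := wE z Uz; rewrite gt_eqF.
move=> z Uz; have [l l0 [e00 e11 e01 NE ffE]] := wE z Uz.
have l_0 : l != 0 by rewrite gt_eqF.
have a0 : dot (F z) (F z) != 0 by rewrite dotxx_eq0 F0.
have N0 : dot (normal_coef F z) (pd 0 F z) = 0.
  by rewrite NE dotZl dotC dot_crossl mulr0.
have N1 : dot (normal_coef F z) (pd 1 F z) = 0.
  by rewrite NE dotZl dotC dot_crossr mulr0.
split; first exact: F0.
- split => //; last by rewrite e00.
  rewrite NE dotZl dotZr dot_cross_cross e00 e11 e01.
  by rewrite [dot (pd 1 F z) _]dotC e01; field.
- rewrite NE; have -> : forall (c : R) (v w : 'rV[R]_3), cross (c *: v) w = c *: cross v w.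
    by move=> c v w; apply: rV3P; rewrite !vecE; ring.
  rewrite crossC double_cross e00 e01 scale0r sub0r opprK scalerA mulVf//.
  by rewrite scale1r.
- have T : dot (cov_deriv F z 0 0) (normal_coef F z)
      + dot (cov_deriv F z 1 1) (normal_coef F z) = 0.
    have := H0 z Uz.
    rewrite /mean_curvature ffE invmx_scalar mul_scalar_mx mxtraceZ.
    rewrite /mxtrace big_ord_recl big_ord1 !second_ffE.
    rewrite (_ : lift ord0 ord0 = 1); last exact: val_inj.
    have en0 : enorm (F z) != 0 by rewrite gt_eqF// enorm_gt0 F0.
    rewrite -mulrDr => /eqP; rewrite !(mulf_eq0, invr_eq0) (negPf l_0) (negPf a0).
    by rewrite (negPf en0) pnatr_eq0/= => /eqP.
  have E0 := cov_deriv_normal (F0 z Uz) N0.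
  have E1 := cov_deriv_normal (F0 z Uz) N1.
  move: (etrans (esym (congr2 +%R E0 E1)) T).
  rewrite e00 e11 dotDr.
  move: (dot (normal_coef F z) _) (dot (normal_coef F z) _) => p q.
  move: (dot (F z) _) (dot (F z) _) a0 => m a a0 E.
  apply/eqP; rewrite -subr_eq0; apply/eqP.
  by rewrite -[RHS](mul0r a) -E; field.
Qed.

End MeanCurvature.

(** * Changes of chart and the Gauss map *)

Lemma connected_locally_constant (T : topologicalType) (A : Type) (f : T -> A) :
  connected [set: T] -> (forall p, \forall q \near p, f q = f p) ->
  forall p q, f p = f q.
Proof.
move=> cT lc p q.
have clopen B : open [set x | B (f x)].
  rewrite openE => x /= Bx; rewrite /interior.
  by have := lc x; apply: filterS => y /= ->.
have : [set x | f x = f p] = setT.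
  apply: cT; first by exists p.
    exists [set x | f x = f p]; last by rewrite setTI.
    exact: (clopen (fun v => v = f p)).
  exists [set x | f x = f p]; last by rewrite setTI.
  rewrite -[X in closed X]setCK; apply: open_closedC.
  exact: (clopen (fun v => v <> f p)).
by move=> /seteqP[_ /(_ q I)] /=.
Qed.

Section ChangeOfCoordinates.
Context {R : realType}.

Lemma det_mx2 (A : 'M[R]_2) : \det A = A 0 0 * A 1 1 - A 0 1 * A 1 0.
Proof.
rewrite (expand_det_row _ 0) big_ord_recl big_ord1 /cofactor !det_mx11 !mxE.
have e1 : lift (0 : 'I_2) (0 : 'I_1) = 1 by exact: val_inj.
have e0 : lift (1 : 'I_2) (0 : 'I_1) = 0 by exact: val_inj.
rewrite (_ : ord0 = 0 :> 'I_1)// (_ : ord0 = 0 :> 'I_2)// !e1 e0.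
by rewrite /= expr0 expr1; ring.
Qed.

Lemma chain_rule (F G : 'rV[R]_2 -> 'rV[R]_3) (t : 'rV[R]_2 -> 'rV[R]_2) z a :
  (\forall y \near z, F y = G (t y)) ->
  differentiable t z -> differentiable G (t z) ->
  pd a F z = 'J t z a 0 *: pd 0 G (t z) + 'J t z a 1 *: pd 1 G (t z).
Proof.
move=> FG dt dG; rewrite pdE /partial (near_eq_derive _ (FG : \near z, F z = (G \o t) z)).
rewrite deriveE; last exact: differentiable_comp.
rewrite diff_comp//= -(deriveE _ dt) -(deriveE _ dG) derive_sum_partial//.
rewrite big_ord_recl big_ord1 (_ : lift ord0 ord0 = 1); last exact: val_inj.
by rewrite deriveEjacobian// -rowE !mxE pdE.
Qed.

(** The Jacobian determinant multiplies the cross product of the partial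
    derivatives, and a positive factor disappears in the normalisation. *)
Lemma normal_coef_chart (F G : 'rV[R]_2 -> 'rV[R]_3) (t : 'rV[R]_2 -> 'rV[R]_2) z :
  (\forall y \near z, F y = G (t y)) ->
  differentiable t z -> differentiable G (t z) -> 0 < \det ('J t z) ->
  normal_coef F z = normal_coef G (t z).
Proof.
move=> FG dt dG; rewrite det_mx2 /normal_coef -pdE.
rewrite !(chain_rule _ FG dt dG); move: ('J t z) (pd 0 G _) (pd 1 G _) => J u v.
set d := _ - _ => d0.
have -> : cross (J 0 0 *: u + J 0 1 *: v) (J 1 0 *: u + J 1 1 *: v) = d *: cross u v.
  by apply: rV3P; rewrite !vecE /d; ring.
rewrite /enorm dotZl dotZr mulrA -expr2 sqrtrM ?sqr_ge0// sqrtr_sqr gtr0_norm//.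
by rewrite scalerA invfM mulrAC mulVf ?mul1r// gt_eqF.
Qed.

(** With zeta the common image, (|zeta|^2 + 1) (1 + n_3) = 2 recovers n_3. *)
Lemma stereographic_inj (n m : 'rV[R]_3) : dot n n = 1 -> dot m m = 1 ->
  stereographic n = stereographic m -> n = m.
Proof.
have div (a b c : R) : c != 0 -> Complex a b / Complex c 0 = Complex (a / c) (b / c).
  move=> c0; have C0 : Complex c 0 != 0 by rewrite eq_complex /= negb_and c0.
  apply: (canLR (mulfK C0)); apply/eqP; rewrite eq_complex /=.
  by rewrite !mulr0 subr0 add0r !divfK// !eqxx.
have pole (k : 'rV[R]_3) : dot k k = 1 -> k 0 2 = -1 -> k 0 0 = 0 /\ k 0 1 = 0.
  rewrite dotE -!expr2 => + k2; rewrite k2 sqrrN expr1n.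
  rewrite -[X in _ = X -> _]add0r => /addIr/eqP.
  by rewrite paddr_eq0 ?sqr_ge0// !sqrf_eq0 => /andP[/eqP -> /eqP ->].
rewrite /stereographic => nn mm; case: eqP => n2; case: eqP => m2 //.
  have [n0 n1] := pole n nn n2; have [m0 m1] := pole m mm m2.
  by move=> _; apply: rV3P; rewrite ?n0 ?n1 ?n2 ?m0 ?m1 ?m2.
have n20 : 1 + n 0 2 != 0 by rewrite addrC addr_eq0; apply/eqP.
have m20 : 1 + m 0 2 != 0 by rewrite addrC addr_eq0; apply/eqP.
rewrite !div// => -[e0 e1]; move: nn mm e0 e1; rewrite !dotE.
move: n20 m20 => {n2 m2}.
move=> n20 m20 nn mm e0 e1.
set s := n 0 0 / (1 + n 0 2) in e0; set t := n 0 1 / (1 + n 0 2) in e1.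
have n0 : n 0 0 = s * (1 + n 0 2) by rewrite divfK.
have n1 : n 0 1 = t * (1 + n 0 2) by rewrite divfK.
have m0 : m 0 0 = s * (1 + m 0 2) by rewrite e0 divfK.
have m1 : m 0 1 = t * (1 + m 0 2) by rewrite e1 divfK.
have key (x : R) : 1 + x != 0 ->
    s * (1 + x) * (s * (1 + x)) + t * (1 + x) * (t * (1 + x)) + x * x = 1 ->
    (s ^+ 2 + t ^+ 2 + 1) * (1 + x) = 2.
  move=> x0 E; apply: (mulIf x0); apply/eqP; rewrite -subr_eq0; apply/eqP.
  by move/eqP: E; rewrite -subr_eq0 => /eqP E; rewrite -[RHS]E; ring.
have k0 : s ^+ 2 + t ^+ 2 + 1 != 0 by rewrite gt_eqF// ltr_wpDl// addr_ge0// sqr_ge0.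
have n2m2 : n 0 2 = m 0 2.
  apply: (addrI 1); apply: (mulfI k0); rewrite !key//.
    by rewrite -m0 -m1.
  by rewrite -n0 -n1.
by apply: rV3P => //; rewrite ?n0 ?n1 ?m0 ?m1 n2m2.
Qed.

End ChangeOfCoordinates.

(** * From charts to the surface *)

Local Notation coord := Defs.coord.

Section Surface.
Context {R : realType} {S : riemannian_surface R}.
Implicit Types (X : S -> S2xR R) (c : chart R S) (p : S).

Definition cod c : set 'rV[R]_2 := coord c @` dom c.

Lemma near_param c z (P : S -> Prop) : cod c z ->
  (\forall q \near param c z, P q) -> \forall y \near z, P (param c y).
Proof. by move=> cz Pq; exact: (param_continuous cz) Pq. Qed.

Lemma near_coord c p (P : 'rV[R]_2 -> Prop) : dom c p ->
  (\forall y \near coord c p, P y) -> \forall q \near p, dom c q /\ P (coord c q).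
Proof.
move=> cp Py; have h1 : \forall q \near p, dom c q.
  by apply: open_nbhs_nbhs; split => //; exact: dom_open.
have h2 : \forall q \near p, P (coord c q) by exact: (Defs.coord_continuous cp) Py.
by apply: filterS2 h1 h2.
Qed.

Lemma coord_in_cod c p : dom c p -> cod c (coord c p).
Proof. by move=> cp; exists p. Qed.

Lemma param_dom c z : cod c z -> dom c (param c z) /\ coord c (param c z) = z.
Proof. by move=> [q cq <-]; rewrite coordK. Qed.

Lemma chart_atP p : atlas (chart_at p) /\ dom (chart_at p) p.
Proof. by rewrite /chart_at; case: cid. Qed.

Lemma locally_constant_of_chart c p (A : Type) (f : S -> A) : dom c p ->
  (\forall y \near coord c p, f (param c y) = f p) -> \forall q \near p, f q = f p.
Proof.
move=> cp /(near_coord cp); apply: filterS => q [cq].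
by rewrite coordK.
Qed.

Lemma locally_constant_in_chart c p (A : Type) (f : S -> A) : dom c p ->
  (\forall q \near p, f q = f p) -> \forall y \near coord c p, f (param c y) = f p.
Proof.
move=> cp fp; apply: (@near_param c _ (fun q => f q = f p)).
  exact: coord_in_cod.
by rewrite coordK.
Qed.

Lemma dot_model (q : S2xR R) : dot (model q) (model q) = expR q.2 ^+ 2.
Proof.
rewrite /model dotZl dotZr; case: q => -[y /= /eqP ->] t /=.
by rewrite mulr1 expr2.
Qed.

Lemma model_neq0 (q : S2xR R) : model q != 0.
Proof. by rewrite -dotxx_gt0 dot_model exprn_gt0// expR_gt0. Qed.

Lemma chart_patch X c : minimal_conformal_immersion X -> atlas c ->
  minimal_patch (cod c) (local_rep X c) (normal_coef (local_rep X c)).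
Proof.
move=> [iX cX mX] ac; have [sX _] := iX c ac.
apply: (@minimal_patch_of_chart R _ _ (cfactor c)) => //.
- exact: cod_open.
- by move=> z _; exact: model_neq0.
- exact: cfactor_gt0.
- exact: cX.
- exact: mX.
Qed.

Definition normal X p : 'rV[R]_3 :=
  normal_coef (local_rep X (chart_at p)) (coord (chart_at p) p).

Lemma normal_coef_local_rep X c c' p : immersion X -> atlas c -> atlas c' ->
  dom c p -> dom c' p -> normal_coef (local_rep X c) (coord c p) =
                         normal_coef (local_rep X c') (coord c' p).
Proof.
move=> iX ac ac' cp c'p.
have ov : overlap c c' (coord c p) by exists p.
have te : transition c c' (coord c p) = coord c' p by rewrite /transition /= coordK.
rewrite -te; apply: normal_coef_chart.
- have : \forall y \near coord c p, dom c' (param c y).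
    apply: (@near_param c _ (fun q => dom c' q)); first exact: coord_in_cod.
    by rewrite coordK//; apply: open_nbhs_nbhs; split => //; exact: dom_open.
  by apply: filterS => y c'y; rewrite /local_rep /transition /= coordK.
- exact: (smooth_differentiable (transition_smooth ac ac')).
- rewrite te; have [sX _] := iX c' ac'.
  by apply: (smooth_differentiable sX); exists p.
- exact: transition_oriented.
Qed.

Lemma normal_coefE X c z : immersion X -> atlas c -> cod c z ->
  normal_coef (local_rep X c) z = normal X (param c z).
Proof.
move=> iX ac cz; have [cp pz] := param_dom cz.
have [ac' c'p] := chart_atP (param c z).
by rewrite -{1}pz; exact: normal_coef_local_rep.
Qed.

Lemma normal_unit X p : minimal_conformal_immersion X -> dot (normal X p) (normal X p) = 1.
Proof.
move=> mX; have [ac cp] := chart_atP p.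
exact: (patch_unit (chart_patch mX ac) (coord_in_cod cp)).
Qed.

Lemma normal_eq X Xh p : minimal_conformal_immersion X ->
  minimal_conformal_immersion Xh -> gauss_map Xh p = gauss_map X p ->
  normal Xh p = normal X p.
Proof. by move=> mX mXh; apply: stereographic_inj; exact: normal_unit. Qed.

Lemma minimal_patch_ext (U : set 'rV[R]_2) (F N N' : 'rV[R]_2 -> 'rV[R]_3) :
  open U -> (forall z, U z -> N z = N' z) ->
  minimal_patch U F N -> minimal_patch U F N'.
Proof.
move=> Uo NN' [sF sN p]; split => //; first exact: smooth_ext NN' sN.
by move=> z Uz; rewrite -NN'//; exact: p.
Qed.

(** Otherwise tilt0_dN makes the normal locally constant in every chart. *)
Lemma exists_tilt_neq0 X : minimal_conformal_immersion X ->
  ~ (exists w, forall p, gauss_map X p = w) ->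
  exists c p, [/\ atlas c, dom c p &
    tilt (local_rep X c) (normal_coef (local_rep X c)) (coord c p) != 0].
Proof.
move=> mX ng; apply: contra_notP ng => nt.
have lc p : \forall q \near p, normal X q = normal X p.
  have [ac cp] := chart_atP p; set c := chart_at p in ac cp.
  have patch := chart_patch mX ac; have co : open (cod c) := @cod_open R S c.
  apply: (locally_constant_of_chart cp).
  have t0 z : cod c z -> tilt (local_rep X c) (normal_coef (local_rep X c)) z = 0.
    move=> [q cq <-]; apply/eqP/negPn/negP => t0; apply: nt.
    by exists c, q.
  have dN := tilt0_dN co patch t0.
  have [e e0 zU] := open_ball_sub co (coord_in_cod cp).
  have [_ sN _] := patch; have [iX _ _] := mX.
  apply/nbhs_ballP; exists e; first exact: e0.
  move=> y zy.
  rewrite -(normal_coefE iX ac (zU y zy)).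
  rewrite -[X in _ = normal _ X](coordK cp) -(normal_coefE iX ac (coord_in_cod cp)).
  apply/rowP => k.
  apply: (constant_on_ball (smooth_vec_coord k co sN) zU _ zy) => a x Ux.
  by rewrite -(partial_vec a k sN Ux) dN// mxE.
have cst := connected_locally_constant (@surface_connected R S) lc.
have [[p0 _]|np] := pselect (exists p : S, True).
  exists (gauss_map X p0) => p.
  by rewrite /gauss_map -/(normal X p) -/(normal X p0) (cst p p0).
by exists None => p; case: np; exists p.
Qed.

Section TwoImmersions.
Variables X Xh : S -> S2xR R.
Hypothesis mX : minimal_conformal_immersion X.
Hypothesis mXh : minimal_conformal_immersion Xh.
Hypothesis normals : forall p, normal Xh p = normal X p.

Let patch c : atlas c -> minimal_patch (cod c) (local_rep X c)
  (normal_coef (local_rep X c)).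
Proof. exact: chart_patch. Qed.

Let patchh c : atlas c -> minimal_patch (cod c) (local_rep Xh c)
  (normal_coef (local_rep X c)).
Proof.
move=> ac; apply: minimal_patch_ext (chart_patch mXh ac); first exact: cod_open.
have [iX _ _] := mX; have [iXh _ _] := mXh.
by move=> z cz; rewrite !normal_coefE.
Qed.

Definition surface_norm_ratio p : R :=
  dot (model (Xh p)) (model (Xh p)) / dot (model (X p)) (model (X p)).

Definition surface_dot_ratio p : R :=
  dot (model (Xh p)) (model (X p)) / dot (model (X p)) (model (X p)).

Lemma homothety_at c p : atlas c -> dom c p ->
  tilt (local_rep X c) (normal_coef (local_rep X c)) (coord c p) != 0 ->
  exists2 r, r != 0 & \forall q \near p, model (Xh q) = r *: model (X q).
Proof.
move=> ac cp t0; have co : open (cod c) := @cod_open R S c.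
have [r r0 H] := local_homothety co (patch ac) (patchh ac) (coord_in_cod cp) t0.
exists r => //; have := near_coord cp H; apply: filterS => q [cq].
by rewrite /local_rep coordK.
Qed.

(** The set near whose points the ratio is constant is open, and closed by
    norm_ratio_continuation; it contains p by homothety_at. *)
Lemma norm_ratio_constant c p : atlas c -> dom c p ->
  tilt (local_rep X c) (normal_coef (local_rep X c)) (coord c p) != 0 ->
  forall q q', surface_norm_ratio q = surface_norm_ratio q'.
Proof.
move=> ac cp t0.
pose E := [set q | \forall q' \near q, surface_norm_ratio q' = surface_norm_ratio q].
suff ET : E = setT.
  apply: connected_locally_constant; first exact: surface_connected.
  by move=> q; have : E q by rewrite ET.
have Eo : open E.
  rewrite openE => q /nbhs_interior; apply: filterS => q' Eq'; rewrite /E /=.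
  by have := Eq'; apply: filterS => q'' ->; rewrite (nbhs_singleton Eq').
have Ec : closed E.
  move=> q clq; have [aq cq] := chart_atP q; set d := chart_at q in aq cq.
  have co : open (cod d) := @cod_open R S d.
  have [e e0 cont] := norm_ratio_continuation co (patch aq) (patchh aq) (coord_in_cod cq).
  have nq : \forall q' \near q, dom d q' /\ ball (coord d q) e (coord d q').
    by apply: near_coord => //; exact: nbhsx_ballx.
  have [q' [Eq' [dq' bq']]] := clq _ nq.
  apply: (locally_constant_of_chart cq).
  have := cont _ bq'; rewrite /norm_ratio /local_rep !coordK//; apply.
  exact: locally_constant_in_chart dq' Eq'.
apply: (@surface_connected R S).
- have [r r0 H] := homothety_at ac cp t0.
  exists p; have := H; apply: filterS => q' Hq'.
  have scale (v : 'rV[R]_3) : v != 0 -> dot (r *: v) (r *: v) / dot v v = r * r.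
    by rewrite -dotxx_eq0 => v0; rewrite dotZl dotZr mulrA mulfK.
  by rewrite /surface_norm_ratio Hq' (nbhs_singleton H) !scale ?model_neq0.
- by exists E => //; rewrite setTI.
- by exists E => //; rewrite setTI.
Qed.

Lemma dot_ratio_constant : (forall q q', surface_norm_ratio q = surface_norm_ratio q') ->
  forall q q', surface_dot_ratio q = surface_dot_ratio q'.
Proof.
move=> nc; apply: connected_locally_constant; first exact: surface_connected.
move=> q; have [aq cq] := chart_atP q; set d := chart_at q in aq cq.
have co : open (cod d) := @cod_open R S d.
apply: (locally_constant_of_chart cq).
have [e e0 zU] := open_ball_sub co (coord_in_cod cq).
apply/nbhs_ballP; exists e; first exact: e0.
  move=> y zy.
have K := @constant_on_ball R 2 (cod d) (dot_ratio (local_rep X d) (local_rep Xh d)) _ e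
   (smooth_dot_ratio co (patch aq) (patchh aq)) zU _ y zy.
rewrite -[in RHS](coordK cq); apply: K => a x Ux.
apply: (pd_dot_ratio co (patch aq) (patchh aq) _ Ux) => b.
have nc' z : cod d z -> norm_ratio (local_rep X d) (local_rep Xh d) z = surface_norm_ratio q.
  by move=> _; exact: nc.
by rewrite (partial_ext b co nc' Ux) partial_cst.
Qed.

(** Equality case of the Cauchy-Schwarz inequality: |Fh - k F|^2 = 0. *)
Lemma global_homothety c p : atlas c -> dom c p ->
  tilt (local_rep X c) (normal_coef (local_rep X c)) (coord c p) != 0 ->
  exists2 k, k != 0 & forall q, model (Xh q) = k *: model (X q).
Proof.
move=> ac cp t0; have nc := norm_ratio_constant ac cp t0.
have dc := dot_ratio_constant nc.
have [r r0 /nbhs_singleton H] := homothety_at ac cp t0.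
exists r => // q.
have n0 q' : dot (model (X q')) (model (X q')) != 0 by rewrite dotxx_eq0 model_neq0.
have := nc q p; have := dc q p; rewrite /surface_dot_ratio /surface_norm_ratio H.
move: (model (X p)) (n0 p) (model (X q)) (n0 q) (model (Xh q)) => v v0 w w0 wh.
rewrite !dotZl !dotZr mulrA !mulfK//.
move=> /(canRL (divfK w0)) d1 /(canRL (divfK w0)) d2.
apply/eqP; rewrite -subr_eq0 -dotxx_eq0 !dotBl !dotBr !dotZl !dotZr d2.
by rewrite [dot w wh]dotC d1; apply/eqP; ring.
Qed.

End TwoImmersions.

Lemma sphere2_eq (y y' : sphere2 R) : sval y = sval y' -> y = y'.
Proof. exact: val_inj. Qed.

(** The homothety by k in R^3 is the translation by log |k| of the factor R,
    composed with the antipodal map of the sphere when k < 0. *)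
Lemma homothety_isometry (q qh : S2xR R) (k : R) : k != 0 ->
  model qh = k *: model q ->
  qh.2 = q.2 + ln `|k| /\ sval qh.1 = Num.sg k *: sval q.1.
Proof.
move=> k0 E; have nk : 0 < `|k| by rewrite normr_gt0.
have t : expR qh.2 = `|k| * expR q.2.
  apply/eqP; rewrite -(eqrXn2 (ltn0Sn 1)) ?mulr_ge0 ?expR_ge0//.
  rewrite -dot_model E dotZl dotZr dot_model exprMn real_normK ?num_real//.
  by rewrite mulrA -expr2.
split.
  by rewrite -[LHS]expRK t lnM ?posrE ?expR_gt0// expRK addrC.
have : expR qh.2 *: sval qh.1 = expR qh.2 *: (Num.sg k *: sval q.1).
  rewrite -[LHS]/(model qh) E /model !scalerA t; congr (_ *: _).
  by rewrite mulrAC [`|k| * _]mulrC -numEsg.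
move/(congr1 (fun v => (expR qh.2)^-1 *: v)).
by rewrite !scalerA mulVf ?mul1r ?scale1r// gt_eqF// expR_gt0.
Qed.

End Surface.

Theorem theorem4p15 (R : realType) (S : riemannian_surface R)
    (X Xhat : S -> S2xR R)
    (hX : minimal_conformal_immersion X)
    (hg : ~ (exists w, forall p : S, gauss_map X p = w))
    (hXhat : minimal_conformal_immersion Xhat)
    (hgauss : forall p : S, gauss_map Xhat p = gauss_map X p) :
  exists f : S2xR R -> S2xR R,
    (exists s : R,
        f = prod_map (fun y => y) (translation s) \/
        f = prod_map (@antipode R) (translation s)) /\
    (forall p : S, Xhat p = f (X p)).
Proof.
have [c [p0 [ac cp t0]]] := exists_tilt_neq0 hX hg.
have normals p : normal Xhat p = normal X p by exact: normal_eq.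
have [k k0 H] := global_homothety hX hXhat normals ac cp t0.
have iso p := homothety_isometry k0 (H p).
have [kp|kn] := ltP 0 k.
  exists (prod_map (fun y => y) (translation (ln `|k|))); split.
    by exists (ln `|k|); left.
  move=> p; have [e1 e2] := iso p; rewrite gtr0_sg// scale1r in e2.
  by rewrite (surjective_pairing (Xhat p)) e1 (sphere2_eq e2).
exists (prod_map (@antipode R) (translation (ln `|k|))); split.
  by exists (ln `|k|); right.
move=> p; have [e1 e2] := iso p.
rewrite ltr0_sg ?scaleN1r in e2; last by rewrite lt_neqAle k0.
rewrite (surjective_pairing (Xhat p)) e1 /prod_map /translation; congr (_, _).
exact: sphere2_eq.
Qed.
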